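(* Let $k$ be an algebraically closed field and let $\mathbb X\subset\mathbb P^1(k)=k\cup\{\infty\}$ be any subset such that $\infty\in\mathbb X$. Then the following assertions hold. (a) Any $\mathbb X$-comodule $M$ has a unique, functorial decomposition into a direct sum of $\{\lambda\}$-comodules $M_\lambda$ over $\lambda\in\mathbb X$, and any such direct sum $M=\bigoplus_{\lambda\in\mathbb X}M_\lambda$ of $\{\lambda\}$-comodules $M_\lambda$ is an $\mathbb X$-comodule. The category of $\mathbb X$-comodules is thus equivalent to the Cartesian product of the categories of $\{\lambda\}$-comodules over $\lambda\in\mathbb X$ (each of which is equivalent to the category of $k$-vector spaces with a locally nilpotent linear operator $z$). (b) Any $\mathbb X$-contramodule $C$ has a unique, functorial decomposition into a direct product of $\{\lambda\}$-contramodules $C^\lambda$ over $\lambda\in\mathbb X$, and any such direct product $C=\prod_{\lambda\in\mathbb X}C^\lambda$ of $\{\lambda\}$-contramodules $C^\lambda$ is an $\mathbb X$-contramodule. The category of $\mathbb X$-contramodules is thus equivalent to the Cartesian product of the categories of $\{\lambda\}$-contramodules over $\lambda\in\mathbb X$ (each of which is equivalent to the category of $k$-vector spaces with a $z$-power infinite summation operation).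
   Context: $R$ is the path algebra over $k$ of the Kronecker quiver $\bullet\rightrightarrows\bullet$; left $R$-modules are identified with Kronecker quiver representations $V=(f_V,g_V)$, i.e. pairs of $k$-vector spaces $(V_1,V_2)$ (of arbitrary dimension) with a pair of $k$-linear maps $f_V,g_V\colon V_1\rightrightarrows V_2$. $\operatorname{Hom}_R$ and $\operatorname{Ext}^1_R$ are computed in this abelian category. For a nonempty subset $\mathbb X\subset\mathbb P^1(k)$, consider the class of representations $V$ such that $g_V-\lambda f_V\colon V_1\to V_2$ is invertible for every $\lambda\in\mathbb X\setminus\{\infty\}$ and, if $\infty\in\mathbb X$, also $f_V$ is invertible. A representation $M$ is an $\mathbb X$-comodule if $\operatorname{Hom}_R(M,V)=0=\operatorname{Ext}^1_R(M,V)$ for every such $V$. A representation $C$ is an $\mathbb X$-contramodule if $\operatorname{Hom}_R(V,C)=0=\operatorname{Ext}^1_R(V,C)$ for every such $V$. These form full subcategories of the category of Kronecker quiver representations; for $\mathbb X=\{\lambda\}$ one obtains the $\{\lambda\}$-comodules and $\{\lambda\}$-contramodules. A linear operator $z$ on $M$ is locally nilpotent if for every $m\in M$ there is $n\ge1$ with $z^nm=0$. A $z$-power infinite summation operation on a $k$-vector space $C$ is a $k$-linear map $\prod_{n\ge0}C\to C$, written $(c_n)_{n\ge0}\mapsto\sum_{n\ge0}z^nc_n$, such that $\sum_n z^nc_n=c_0$ whenever $c_n=0$ for all $n\ge1$, and $\sum_{i\ge0}z^i\bigl(\sum_{j\ge0}z^jc_{ij}\bigr)=\sum_{n\ge0}z^n\bigl(\sum_{i+j=n}c_{ij}\bigr)$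 for every double sequence $(c_{ij})_{i,j\ge0}$ in $C$; morphisms are the $k$-linear maps preserving the operation. *)

(* Defs.v *)
From HB Require Import structures.
From mathcomp Require Import all_boot all_order all_algebra.
From mathcomp Require Import boolp classical_sets functions cardinality.

Set Implicit Arguments.
Unset Strict Implicit.
Unset Printing Implicit Defensive.

Import GRing.Theory.

Local Open Scope classical_set_scope.
Local Open Scope ring_scope.

#[local] Obligation Tactic := idtac.

Record category := Category {
  obj :> Type;
  hom : obj -> obj -> Type;
  idm : forall a, hom a a;
  compm : forall a b c, hom b c -> hom a b -> hom a c;
  comp1m : forall a b (f : hom a b), compm (idm b) f = f;
  compm1 : forall a b (f : hom a b), compm f (idm a) = f;
  compA : forall a b c d (h : hom c d) (g : hom b c) (f : hom a b),
    compm h (compm g f) = compm (compm h g) f }.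

Arguments hom {C} a b : rename.
Arguments idm {C} a : rename.
Arguments compm {C} [a b c] g f : rename.

Definition is_iso (C : category) (a b : C) (f : hom a b) : Prop :=
  exists g : hom b a, compm g f = idm a /\ compm f g = idm b.

Record functor (C D : category) := Functor {
  fobj :> C -> D;
  fmap : forall a b, hom a b -> hom (fobj a) (fobj b);
  fmap1 : forall a, fmap (idm a) = idm (fobj a);
  fmapM : forall a b c (g : hom b c) (f : hom a b),
    fmap (compm g f) = compm (fmap g) (fmap f) }.

Arguments fmap {C D} F [a b] f : rename.

Section FunctorOps.
Variables C D E : category.

Definition idF : functor C C :=
  @Functor C C id (fun _ _ f => f) (fun _ => erefl) (fun _ _ _ _ _ => erefl).

Program Definition compF (G : functor D E) (F : functor C D) : functor C E :=
  @Functor C E (fun a => G (F a)) (fun _ _ f => fmap G (fmap F f)) _ _.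
Next Obligation. by move=> G F a /=; rewrite !fmap1. Qed.
Next Obligation. by move=> G F a b c g f /=; rewrite !fmapM. Qed.

End FunctorOps.

Definition nat_iso (C D : category) (F G : functor C D) : Prop :=
  exists t : forall a : C, hom (F a) (G a),
    (forall a, is_iso (t a)) /\
    (forall (a b : C) (f : hom a b),
       compm (t b) (fmap F f) = compm (fmap G f) (t a)).

Definition is_equivalence (C D : category) (F : functor C D) : Prop :=
  exists G : functor D C,
    nat_iso (compF G F) (idF C) /\ nat_iso (compF F G) (idF D).

Definition equivalent (C D : category) : Prop :=
  exists F : functor C D, is_equivalence F.

Definition full_subcat (C : category) (P : C -> Prop) : category :=
  @Category {a : C | P a} (fun a b => hom (sval a) (sval b))
    (fun a => idm (sval a)) (fun _ _ _ g f => compm g f)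
    (fun _ _ => @comp1m C _ _) (fun _ _ => @compm1 C _ _)
    (fun _ _ _ _ => @compA C _ _ _ _).

Program Definition prod_cat (I : Type) (C : I -> category) : category :=
  @Category (forall i, C i) (fun a b => forall i, hom (a i) (b i))
    (fun a i => idm (a i)) (fun _ _ _ g f i => compm (g i) (f i)) _ _ _.
Next Obligation.
by move=> I C a b f; apply: functional_extensionality_dep => i /=; rewrite comp1m.
Qed.
Next Obligation.
by move=> I C a b f; apply: functional_extensionality_dep => i /=; rewrite compm1.
Qed.
Next Obligation.
by move=> I C a b c d h g f; apply: functional_extensionality_dep => i /=; rewrite compA.
Qed.

Section LinearAlgebra.
Variable k : fieldType.

Lemma linear_ext (U V : lmodType k) (f g : {linear U -> V}) : f =1 g -> f = g.
Proof.
case: f g => f [[mf] [zf]] [g [[mg] [zg]]] /= /funext E.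
case: _ / E in mg zg *.
by rewrite (Prop_irrelevance mf mg) (Prop_irrelevance zf zg).
Qed.

Section PairMap.
Variables (U U' V V' : lmodType k).
Variables (f : {linear U -> V}) (g : {linear U' -> V'}).

Definition pair_map (x : U * U') : V * V' := (f x.1, g x.2).

Fact pair_map_linear : linear pair_map.
Proof. by move=> a x y; rewrite /pair_map /= !linearP. Qed.

HB.instance Definition _ := GRing.isLinear.Build k (U * U')%type (V * V')%type _
  pair_map pair_map_linear.

End PairMap.

Section Inclusions.
Variables U V : lmodType k.

Definition pair_inl (x : U) : U * V := (x, 0).

Fact pair_inl_linear : linear pair_inl.
Proof. by move=> a x y; congr pair; rewrite /= scaler0 addr0. Qed.

HB.instance Definition _ := GRing.isLinear.Build k U (U * V)%type _
  pair_inl pair_inl_linear.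

Definition pair_snd (x : U * V) : V := x.2.

Fact pair_snd_linear : linear pair_snd.
Proof. by []. Qed.

HB.instance Definition _ := GRing.isLinear.Build k (U * V)%type V _
  pair_snd pair_snd_linear.

End Inclusions.

Section ProductSpace.
Variables (I : Type) (V : I -> lmodType k).

Definition dprod : Type := forall i, V i.

HB.instance Definition _ := gen_eqMixin dprod.
HB.instance Definition _ := gen_choiceMixin dprod.

Implicit Types x y z : dprod.

Fact dprod_addA : associative (fun x y : dprod => (fun i => x i + y i) : dprod).
Proof. by move=> x y z; apply: functional_extensionality_dep => i; rewrite addrA. Qed.

Fact dprod_addC : commutative (fun x y : dprod => (fun i => x i + y i) : dprod).
Proof. by move=> x y; apply: functional_extensionality_dep => i; rewrite addrC. Qed.

Fact dprod_add0 :
  left_id (fun i => 0) (fun x y : dprod => (fun i => x i + y i) : dprod).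
Proof. by move=> x; apply: functional_extensionality_dep => i; rewrite add0r. Qed.

Fact dprod_addN : left_inverse (fun i => 0) (fun x : dprod => (fun i => - x i) : dprod)
  (fun x y : dprod => (fun i => x i + y i) : dprod).
Proof. by move=> x; apply: functional_extensionality_dep => i; rewrite addNr. Qed.

HB.instance Definition _ := GRing.isZmodule.Build dprod
  dprod_addA dprod_addC dprod_add0 dprod_addN.

Definition dprod_scale (a : k) (x : dprod) : dprod := fun i => a *: x i.

Fact dprod_scaleA a b x :
  dprod_scale a (dprod_scale b x) = dprod_scale (a * b) x.
Proof. by apply: functional_extensionality_dep => i; rewrite /dprod_scale scalerA. Qed.

Fact dprod_scale1 : left_id 1 dprod_scale.
Proof.
by move=> x; apply: functional_extensionality_dep => i; rewrite /dprod_scale scale1r.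
Qed.

Fact dprod_scaleDr : right_distributive dprod_scale +%R.
Proof.
by move=> a x y; apply: functional_extensionality_dep => i; rewrite /dprod_scale scalerDr.
Qed.

Fact dprod_scaleDl x : {morph dprod_scale^~ x : a b / a + b}.
Proof.
by move=> a b; apply: functional_extensionality_dep => i; rewrite /dprod_scale scalerDl.
Qed.

HB.instance Definition _ := GRing.Zmodule_isLmodule.Build k dprod
  dprod_scaleA dprod_scale1 dprod_scaleDr dprod_scaleDl.

Lemma dprodD x y i : (x + y) i = x i + y i. Proof. by []. Qed.
Lemma dprodZ a x i : (a *: x) i = a *: x i. Proof. by []. Qed.

Definition finsupp : {pred dprod} := fun x => `[< finite_set [set i | x i != 0] >].

Fact finsupp_submod_closed : GRing.subsemimod_closed finsupp.
Proof.
split=> [|a x]; first split.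
- apply/asboolP; rewrite (_ : [set _ | _] = set0) //.
  by rewrite predeqE => i; split=> //=; rewrite eqxx.
- move=> x y /asboolP fx /asboolP fy; apply/asboolP.
  apply: (sub_finite_set _ (_ : finite_set (_ `|` _))); last first.
    by rewrite finite_setU; split; [exact: fx | exact: fy].
  move=> i /=; case: (eqVneq (x i) 0) => [xi0|]; last by left.
  by rewrite dprodD xi0 add0r; right.
- move=> /asboolP fx; apply/asboolP; apply: sub_finite_set fx => i /=.
  by apply: contraNN => /eqP xi0; rewrite dprodZ xi0 scaler0.
Qed.

HB.instance Definition _ := GRing.isSubmodClosed.Build k dprod finsupp
  finsupp_submod_closed.

Record dsum := Dsum { dsum_val :> dprod; _ : dsum_val \in finsupp }.

HB.instance Definition _ := [isSub for dsum_val].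
HB.instance Definition _ := [Choice of dsum by <:].
HB.instance Definition _ := [SubChoice_isSubLmodule of dsum by <:].

End ProductSpace.

Section ProductMap.
Variables (I : Type) (V W : I -> lmodType k) (f : forall i, {linear V i -> W i}).

Definition dprod_map (x : dprod V) : dprod W := fun i => f i (x i).

Fact dprod_map_linear : linear dprod_map.
Proof.
by move=> a x y; apply: functional_extensionality_dep => i; rewrite /dprod_map linearP.
Qed.

HB.instance Definition _ := GRing.isLinear.Build k (dprod V) (dprod W) _
  dprod_map dprod_map_linear.

Fact dsum_map_subproof (x : dsum V) : dprod_map (dsum_val x) \in @finsupp I W.
Proof.
case: x => x /= /asboolP fx; apply/asboolP; apply: sub_finite_set fx => i /=.
by apply: contraNN => /eqP xi0; rewrite /dprod_map xi0 linear0.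
Qed.

Definition dsum_map (x : dsum V) : dsum W := Dsum (dsum_map_subproof x).

Fact dsum_map_linear : linear dsum_map.
Proof. by move=> a x y; apply: val_inj; rewrite /= linearP. Qed.

HB.instance Definition _ := GRing.isLinear.Build k (dsum V) (dsum W) _
  dsum_map dsum_map_linear.

End ProductMap.

End LinearAlgebra.

Section Kronecker.
Variable k : fieldType.

Record krep := Krep {
  kv1 : lmodType k;
  kv2 : lmodType k;
  kf : {linear kv1 -> kv2};
  kg : {linear kv1 -> kv2} }.

Record khom (V W : krep) := Khom {
  kh1 : {linear kv1 V -> kv1 W};
  kh2 : {linear kv2 V -> kv2 W};
  khf : forall v, kf W (kh1 v) = kh2 (kf V v);
  khg : forall v, kg W (kh1 v) = kh2 (kg V v) }.

Lemma khom_ext V W (h h' : khom V W) :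
  kh1 h =1 kh1 h' -> kh2 h =1 kh2 h' -> h = h'.
Proof.
case: h h' => h1 h2 hf hg [h1' h2' hf' hg'] /= /linear_ext E1 /linear_ext E2.
case: _ / E1 in hf' hg' *; case: _ / E2 in hf' hg' *.
by rewrite (Prop_irrelevance hf hf') (Prop_irrelevance hg hg').
Qed.

Program Definition kid V : khom V V := @Khom V V idfun idfun _ _.
Next Obligation. by []. Qed.
Next Obligation. by []. Qed.

Program Definition kcomp U V W (h : khom V W) (h' : khom U V) : khom U W :=
  @Khom U W (kh1 h \o kh1 h') (kh2 h \o kh2 h') _ _.
Next Obligation. by move=> U V W h h' v /=; rewrite !khf. Qed.
Next Obligation. by move=> U V W h h' v /=; rewrite !khg. Qed.

Program Definition kzero V W : khom V W := @Khom V W \0 \0 _ _.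
Next Obligation. by move=> V W v; rewrite linear0. Qed.
Next Obligation. by move=> V W v; rewrite linear0. Qed.

Program Definition krep_cat : category := @Category krep khom kid kcomp _ _ _.
Next Obligation. by move=> V W h; apply: khom_ext. Qed.
Next Obligation. by move=> V W h; apply: khom_ext. Qed.
Next Obligation. by move=> U V W Z h g f; apply: khom_ext. Qed.

Definition kiso V W (h : khom V W) : Prop := @is_iso krep_cat V W h.

(* Ext^1 is Yoneda's: equivalence classes of short exact sequences
   0 -> V -> E -> M -> 0, with the split sequence as zero element. *)

Definition short_exact (A B C : lmodType k) (i : {linear A -> B})
    (p : {linear B -> C}) : Prop :=
  [/\ injective i, range p = setT & range i = [set b | p b = 0]].

Record extension (M V : krep) := Extension {
  ext_mid : krep;
  ext_in : khom V ext_mid;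
  ext_out : khom ext_mid M;
  ext_exact1 : short_exact (kh1 ext_in) (kh1 ext_out);
  ext_exact2 : short_exact (kh2 ext_in) (kh2 ext_out) }.

Definition ext_equiv M V (E E' : extension M V) : Prop :=
  exists h : khom (ext_mid E) (ext_mid E'),
    [/\ kiso h, kcomp h (ext_in E) = ext_in E' &
        kcomp (ext_out E') h = ext_out E].

Definition ksum2 (V M : krep) : krep :=
  Krep (pair_map (kf V) (kf M)) (pair_map (kg V) (kg M)).

Lemma short_exact_pair (A C : lmodType k) :
  short_exact (@pair_inl k A C) (@pair_snd k A C).
Proof.
split.
- by move=> x y [].
- by rewrite predeqE => c; split=> // _; exists (0, c).
- rewrite predeqE => -[a c]; split=> [[x _ [_ <-]]//|/= c0].
  by exists a => //; congr pair.
Qed.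

Program Definition ext_split M V : extension M V :=
  @Extension M V (ksum2 V M)
    (@Khom V (ksum2 V M) (@pair_inl k _ _) (@pair_inl k _ _) _ _)
    (@Khom (ksum2 V M) M (@pair_snd k _ _) (@pair_snd k _ _) _ _)
    (short_exact_pair _ _) (short_exact_pair _ _).
Next Obligation. by move=> M V v; congr pair; rewrite linear0. Qed.
Next Obligation. by move=> M V v; congr pair; rewrite linear0. Qed.
Next Obligation. by []. Qed.
Next Obligation. by []. Qed.

Definition Hom_zero (M V : krep) : Prop := forall h : khom M V, h = kzero M V.

Definition Ext1_zero (M V : krep) : Prop :=
  forall E : extension M V, ext_equiv E (ext_split M V).

(* [Some l] is the point l of k and [None] is the point at infinity. *)
Definition P1 : Type := option k.

Definition invertible_on (X : set P1) (V : krep) : Prop :=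
  (forall l : k, X (Some l) -> bijective (kg V \- l \*: kf V)) /\
  (X None -> bijective (kf V)).

Definition comodule (X : set P1) (M : krep) : Prop :=
  forall V, invertible_on X V -> Hom_zero M V /\ Ext1_zero M V.

Definition contramodule (X : set P1) (C : krep) : Prop :=
  forall V, invertible_on X V -> Hom_zero V C /\ Ext1_zero V C.

Definition comod_cat (X : set P1) : category :=
  @full_subcat krep_cat (comodule X).

Definition contra_cat (X : set P1) : category :=
  @full_subcat krep_cat (contramodule X).

Section Products.
Variable I : Type.

Definition ksum (N : I -> krep) : krep :=
  Krep (dsum_map (fun i => kf (N i))) (dsum_map (fun i => kg (N i))).

Definition kprod (N : I -> krep) : krep :=
  Krep (dprod_map (fun i => kf (N i))) (dprod_map (fun i => kg (N i))).

Program Definition ksum_hom (N N' : I -> krep) (t : forall i, khom (N i) (N' i)) :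
    khom (ksum N) (ksum N') :=
  @Khom (ksum N) (ksum N')
    (dsum_map (fun i => kh1 (t i))) (dsum_map (fun i => kh2 (t i))) _ _.
Next Obligation.
move=> N N' t v; apply: val_inj; apply: functional_extensionality_dep => i.
exact: khf.
Qed.
Next Obligation.
move=> N N' t v; apply: val_inj; apply: functional_extensionality_dep => i.
exact: khg.
Qed.

Program Definition kprod_hom (N N' : I -> krep) (t : forall i, khom (N i) (N' i)) :
    khom (kprod N) (kprod N') :=
  @Khom (kprod N) (kprod N')
    (dprod_map (fun i => kh1 (t i))) (dprod_map (fun i => kh2 (t i))) _ _.
Next Obligation.
by move=> N N' t v; apply: functional_extensionality_dep => i; apply: khf.
Qed.
Next Obligation.
by move=> N N' t v; apply: functional_extensionality_dep => i; apply: khg.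
Qed.

Lemma ksum_hom_id (N : I -> krep) : ksum_hom (fun i => kid (N i)) = kid (ksum N).
Proof. by apply: khom_ext => v; apply: val_inj. Qed.

Lemma ksum_hom_comp (N N' N'' : I -> krep) (t : forall i, khom (N' i) (N'' i))
    (t' : forall i, khom (N i) (N' i)) :
  ksum_hom (fun i => kcomp (t i) (t' i)) = kcomp (ksum_hom t) (ksum_hom t').
Proof. by apply: khom_ext => v; apply: val_inj. Qed.

Lemma kprod_hom_id (N : I -> krep) : kprod_hom (fun i => kid (N i)) = kid (kprod N).
Proof. by apply: khom_ext. Qed.

Lemma kprod_hom_comp (N N' N'' : I -> krep) (t : forall i, khom (N' i) (N'' i))
    (t' : forall i, khom (N i) (N' i)) :
  kprod_hom (fun i => kcomp (t i) (t' i)) = kcomp (kprod_hom t) (kprod_hom t').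
Proof. by apply: khom_ext. Qed.

End Products.

Section Decompositions.
Variable X : set P1.

Definition comod_decomp (M : krep) (N : X -> krep) (i : khom (ksum N) M) : Prop :=
  (forall l : X, comodule [set sval l] (N l)) /\ kiso i.

Definition contra_decomp (C : krep) (N : X -> krep) (p : khom C (kprod N)) : Prop :=
  (forall l : X, contramodule [set sval l] (N l)) /\ kiso p.

Definition comod_sum_functor
    (cl : forall N : X -> krep,
       (forall l : X, comodule [set sval l] (N l)) -> comodule X (ksum N)) :
    functor (prod_cat (fun l : X => comod_cat [set sval l])) (comod_cat X) :=
  @Functor (prod_cat (fun l : X => comod_cat [set sval l])) (comod_cat X)
    (fun N => exist _ (ksum (fun l => sval (N l))) (cl _ (fun l => svalP (N l))))
    (fun _ _ t => ksum_hom t)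
    (fun _ => ksum_hom_id _) (fun _ _ _ _ _ => ksum_hom_comp _ _).

Definition contra_prod_functor
    (cl : forall N : X -> krep,
       (forall l : X, contramodule [set sval l] (N l)) ->
       contramodule X (kprod N)) :
    functor (prod_cat (fun l : X => contra_cat [set sval l])) (contra_cat X) :=
  @Functor (prod_cat (fun l : X => contra_cat [set sval l])) (contra_cat X)
    (fun N => exist _ (kprod (fun l => sval (N l))) (cl _ (fun l => svalP (N l))))
    (fun _ _ t => kprod_hom t)
    (fun _ => kprod_hom_id _) (fun _ _ _ _ _ => kprod_hom_comp _ _).

End Decompositions.

Record locnil := Locnil {
  ln_space : lmodType k;
  ln_op : {linear ln_space -> ln_space};
  ln_nilp : forall m, exists2 n, (1 <= n)%N & iter n ln_op m = 0 }.

Record locnil_hom (A B : locnil) := LocnilHom {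
  lnh : {linear ln_space A -> ln_space B};
  lnhP : forall m, lnh (ln_op A m) = ln_op B (lnh m) }.

Lemma locnil_hom_ext A B (h h' : locnil_hom A B) : lnh h =1 lnh h' -> h = h'.
Proof.
case: h h' => h hP [h' hP'] /= /linear_ext E; case: _ / E in hP' *.
by rewrite (Prop_irrelevance hP hP').
Qed.

Program Definition locnil_cat : category :=
  @Category locnil locnil_hom
    (fun A => @LocnilHom A A idfun _)
    (fun A B C g f => @LocnilHom A C (lnh g \o lnh f) _) _ _ _.
Next Obligation. by []. Qed.
Next Obligation. by move=> A B C g f m /=; rewrite !lnhP. Qed.
Next Obligation. by move=> A B f; apply: locnil_hom_ext. Qed.
Next Obligation. by move=> A B f; apply: locnil_hom_ext. Qed.
Next Obligation. by move=> A B C D h g f; apply: locnil_hom_ext. Qed.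

(* [zs_sum c] is the infinite sum of the z^n c_n. *)
Record zsum := Zsum {
  zs_space : lmodType k;
  zs_sum : {linear (nat -> zs_space) -> zs_space};
  zs_unit : forall c : nat -> zs_space,
    (forall n, (1 <= n)%N -> c n = 0) -> zs_sum c = c 0%N;
  zs_assoc : forall c : nat -> nat -> zs_space,
    zs_sum (fun i => zs_sum (fun j => c i j)) =
    zs_sum (fun n => \sum_(i < n.+1) c i (n - i)%N) }.

Record zsum_hom (A B : zsum) := ZsumHom {
  zsh : {linear zs_space A -> zs_space B};
  zshP : forall c : nat -> zs_space A,
    zsh (zs_sum A c) = zs_sum B (fun n => zsh (c n)) }.

Lemma zsum_hom_ext A B (h h' : zsum_hom A B) : zsh h =1 zsh h' -> h = h'.
Proof.
case: h h' => h hP [h' hP'] /= /linear_ext E; case: _ / E in hP' *.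
by rewrite (Prop_irrelevance hP hP').
Qed.

Program Definition zsum_cat : category :=
  @Category zsum zsum_hom
    (fun A => @ZsumHom A A idfun _)
    (fun A B C g f => @ZsumHom A C (zsh g \o zsh f) _) _ _ _.
Next Obligation. by []. Qed.
Next Obligation. by move=> A B C g f c /=; rewrite !zshP. Qed.
Next Obligation. by move=> A B f; apply: zsum_hom_ext. Qed.
Next Obligation. by move=> A B f; apply: zsum_hom_ext. Qed.
Next Obligation. by move=> A B C D h g f; apply: zsum_hom_ext. Qed.

End Kronecker.

(* Main.v *)
Require Import Defs.
From HB Require Import structures.
From mathcomp Require Import all_boot all_algebra.
From mathcomp Require Import boolp classical_sets functions cardinality fsbigop.

Set Implicit Arguments.
Unset Strict Implicit.
Unset Printing Implicit Defensive.

Import GRing.Theory.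

Local Open Scope classical_set_scope.
Local Open Scope ring_scope.

(** For every point [l] of the projective line, the pencil spanned by [f] and [g] has a
    basis [F], [G] whose second member vanishes at [l]: [F = f] and [G = g - l f] at a
    finite point, [F = g] and [G = f] at infinity ([kF], [kG]).  A representation is
    invertible at [l] when its [G] is bijective.  In this language the two halves of the
    theorem and all points of the line are treated alike.

    A representation [V] invertible at infinity is a vector space with an operator [x].
    Then [Hom(M, V)] and [Ext^1(M, V)] are the kernel and the cokernel of the map that
    sends [h : M2 -> V] to [h g - x h f], and [Hom(V, C)] and [Ext^1(V, C)] those of the
    map that sends [h : V -> C1] to [g h - f h x].  So both vanish when an equation in [h]
    is uniquely solvable.  Over all of the line the relevant [V] are modules over the ring
    [A] obtained from [k[x]] by inverting every [x - c], and partial fractions split [A], as a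
    vector space, into one part for each point: the polynomials for infinity and the
    polar parts at [c] for a finite point [c] ([pfrac], [pf_mulx]).

    Let [M] be a comodule.  Solving [psi g - x psi f = (m |-> m * 1)] with values in
    [M1 * A] (tensor product) and expanding [psi n] in partial fractions produces maps
    [theta_l : M2 -> M1], one for each point.  The pair [(theta_l F_l, F_l theta_l)] is an
    endomorphism of [M]; by uniqueness of solutions [psi] carries it to the projection of
    [A] onto its part at [l].  Hence these endomorphisms are orthogonal idempotents, and
    the coefficient of 1 in the equation says that they add up to the identity.  On the
    image of the idempotent at [l] the map [F_l] is invertible, with inverse [theta_l], and
    [F_l^-1 G_l] is locally nilpotent, because partial fraction expansions are finite;
    such a representation is an [{l}]-comodule ([comodule_point]).  For a contramodule
    [C] the dual construction applies.  A linear map [c : A -> C2] has an integral in [C1],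
    the value at 1 of the solution of [g h - f h x = c]; integrating the maps
    [a |-> (coefficient of a at l) d] gives [theta_l d], and the idempotent at [l] maps the
    integral of [c] to the integral of [c] restricted to the part of [A] at [l]
    ([contra_component_integral]).  As maps out of [A] are arbitrary families of maps out
    of its parts, these idempotents exhibit [C] as a product.

    Finally, an [{l}]-comodule or [{l}]-contramodule is invertible at every other point
    ([comodule_disjoint], [contramodule_disjoint]).  It follows that the idempotents at
    the points outside [X] are zero, and that a morphism between two direct sums of
    [{l}]-comodules, or between two products of [{l}]-contramodules, is diagonal
    ([ksum_hom_diagonal], [kprod_hom_diagonal]).  Uniqueness and functoriality of the
    decomposition and the equivalences with the product categories are consequences.  At a
    single point, [F^-1 G] is the operator [z]: an [{l}]-comodule is a space on which it is
    locally nilpotent, and an [{l}]-contramodule is one on which every system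
    [h_n - z h_(n+1) = c_n] has exactly one solution, with [h_0] the sum of the [z^n c_n]. *)

(** * Linear algebra *)

Lemma dependent_fun_choice (I : Type) (T : I -> Type) (P : forall i, T i -> Prop) :
  (forall i, exists x, P i x) -> exists f : forall i, T i, forall i, P i (f i).
Proof. by move=> H; exists (fun i => sval (cid (H i))) => i; exact: svalP. Qed.

Section LinearMaps.
Variable k : fieldType.
Implicit Types U V W : lmodType k.

Definition build_linear U V (f : U -> V) (fP : linear f) : {linear U -> V} :=
  HB.pack f (GRing.isLinear.Build k U V *:%R f fP).

Lemma linearBZ U V (f : {linear U -> V}) u c v :
  f (u - c *: v) = f u - c *: f v.
Proof. by rewrite linearB (linearZZ f). Qed.

Lemma bijective_linear_inv U V (f : {linear U -> V}) :
  bijective f -> exists g : {linear V -> U}, cancel f g /\ cancel g f.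
Proof.
case=> g fK gK.
have gP : linear g.
  by move=> a x y; apply: (can_inj fK); rewrite linearP !gK.
by exists (build_linear gP).
Qed.

Lemma inj_surj_bijective (U V : Type) (f : U -> V) :
  injective f -> (forall v, exists u, f u = v) -> bijective f.
Proof.
by move=> fI /choice[g gK]; exists g => // u; apply: fI; exact: gK.
Qed.

(** Surjections of spaces of arbitrary dimension split: a subspace maximal among those
    that meet the kernel trivially is mapped isomorphically onto the target. *)
Lemma surj_linear_section U V (p : {linear U -> V}) :
  (forall v, exists u, p u = v) -> exists s : {linear V -> U}, cancel s p.
Proof.
move=> ps.
pose P (S : set U) := (forall a x y, S x -> S y -> S (a *: x + y)) /\
   (forall x, S x -> p x = 0 -> x = 0).
have [F FP Ftot|S [[SD SK] Smax]] := @Zorn_bigcup U P.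
  split=> [a x y [A FA Ax] [B FB By]|x [A FA Ax]]; last exact: (FP _ FA).2.
  have [AB|BA] := Ftot _ _ FA FB.
    by exists B => //; apply: (FP _ FB).1 => //; exact: AB.
  by exists A => //; apply: (FP _ FA).1 => //; exact: BA.
(* The maximal [S] may be empty, since the empty chain has an empty union. *)
pose Q x := S x \/ x = 0.
have QD a x y : Q x -> Q y -> Q (a *: x + y).
  move=> [Sx|->] [Sy|->]; rewrite ?scaler0 ?addr0 ?add0r; last by right.
  - by left; exact: SD.
  - left; have := SD (a - 1) x x Sx Sx.
    by rewrite scalerBl scale1r subrK.
  - by left.
have QK x : Q x -> p x = 0 -> x = 0 by move=> [/SK|->].
have Qv v : exists u, Q u /\ p u = v.
  apply: contrapT => Nv; have [b pb] := ps v.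
  have Nb : ~ S b by move=> Sb; apply: Nv; exists b; split=> //; left.
  pose S' := [set x | exists a s, Q s /\ x = a *: b + s].
  apply: (Smax S'); last split.
  - split=> [x Sx|]; first by exists 0, x; rewrite scale0r add0r; split=> //; left.
    move=> S'S; apply: Nb; apply: S'S; exists 1, 0.
    by rewrite scale1r addr0; split=> //; right.
  - move=> a _ _ [c [s [Qs ->]]] [d [t [Qt ->]]].
    exists (a * c + d), (a *: s + t); split; first exact: QD.
    by rewrite scalerDr scalerDl scalerA addrACA.
  - move=> _ [a [s [Qs ->]]]; rewrite linearD linearZZ pb => e0.
    have [a0|a0] := eqVneq a 0.
      by move: e0; rewrite a0 !scale0r !add0r; exact: QK.
    case: Nv; exists (- a^-1 *: s); split.
      by rewrite -[X in Q X]addr0; apply: QD => //; right.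
    move/eqP: e0; rewrite addrC addr_eq0 => /eqP ps'.
    by rewrite linearZZ ps' scalerN scaleNr opprK scalerA mulVf // scale1r.
have [s sP] := choice Qv.
have sL : linear s.
  move=> a x y; apply/eqP; rewrite -subr_eq0; apply/eqP/QK.
    rewrite -[X in Q X]addrC -scaleN1r; apply: (QD); last exact: (sP _).1.
    by apply: QD; [exact: (sP x).1|exact: (sP y).1].
  by rewrite linearB linearP !(sP _).2 subrr.
by exists (build_linear sL) => v; rewrite /= (sP v).2.
Qed.

Definition locally_nilpotent V (z : V -> V) : Prop :=
  forall v, exists n, iter n z v = 0.

Lemma iter_linear0 V (z : {linear V -> V}) n m v :
  (n <= m)%N -> iter n z v = 0 -> iter m z v = 0.
Proof.
move=> /subnK <- e0; rewrite iterD e0.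
by elim: (m - n)%N => //= j ->; rewrite linear0.
Qed.

Lemma iter_is_linear V (z : {linear V -> V}) n : linear (iter n z).
Proof. by elim: n => [//|n IH] a x y /=; rewrite IH linearP. Qed.

(** With [geometric_exists], this says that [h - y h z = c] is solved by the geometric
    series with terms [y^j c z^j], which is a finite sum at each vector, and by nothing else. *)
Lemma geometric_unique U V (z : {linear U -> U}) (y : {linear V -> V})
    (h : {linear U -> V}) :
  locally_nilpotent z -> (forall u, h u = y (h (z u))) -> forall u, h u = 0.
Proof.
move=> zn hE u; have [n] := zn u.
elim: n u => [|n IH] u; first by move=> /= ->; rewrite linear0.
by rewrite iterSr => /IH e; rewrite hE e linear0.
Qed.

Lemma geometric_exists U V (z : {linear U -> U}) (y : {linear V -> V})
    (c : {linear U -> V}) :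
  locally_nilpotent z ->
  exists h : {linear U -> V}, forall u, h u - y (h (z u)) = c u.
Proof.
move=> zn; have [n nP] := choice zn.
(* [S m u] does not depend on [m] once [z^m u = 0], which makes the sum linear in [u]. *)
pose S m u := \sum_(j < m) iter j y (c (iter j z u)).
have Sle m m' u : (m <= m')%N -> iter m z u = 0 -> S m' u = S m u.
  move=> mm' e0; rewrite /S -(subnKC mm') big_split_ord /=.
  rewrite [X in _ + X]big1 ?addr0 // => i _.
  rewrite (iter_linear0 (leq_addr i m) e0) linear0.
  by elim: (m + i)%N => //= j ->; rewrite linear0.
have Sn m u : iter m z u = 0 -> S (n u) u = S m u.
  move=> e0; case: (leqP m (n u)) => [l|/ltnW l]; first exact: Sle.
  by rewrite (Sle _ _ _ l).
have Sl : linear (fun u => S (n u) u).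
  move=> a u v; pose m := maxn (n u) (n v).
  have mu : iter m z u = 0 by apply: iter_linear0 (nP u); exact: leq_maxl.
  have mv : iter m z v = 0 by apply: iter_linear0 (nP v); exact: leq_maxr.
  rewrite (Sn m u) // (Sn m v) // (Sn m); last first.
    by rewrite iter_is_linear mu mv scaler0 addr0.
  rewrite /S scaler_sumr -big_split /=; apply: eq_bigr => j _.
  by rewrite iter_is_linear linearP iter_is_linear.
exists (build_linear Sl) => u /=.
have e1 : iter (n u).+1 z u = 0 by rewrite iterS nP linear0.
rewrite (Sn (n u) (z u)); last by rewrite -iterSr.
rewrite (Sn (n u).+1 u) // /S big_ord_recl linear_sum /=.
rewrite [X in _ - X](eq_bigr (fun i : 'I_(n u) => iter (bump 0 i) y (c (iter (bump 0 i) z u)))).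
  by rewrite addrK.
by move=> i _; rewrite -iterSr.
Qed.

Lemma locally_nilpotent_add_bijective V (z : {linear V -> V}) (a : k) :
  a != 0 -> locally_nilpotent z -> bijective (fun v => a *: v + z v).
Proof.
move=> a0 zn; apply: inj_surj_bijective => [u v /= e|v].
  have e0 : a *: (u - v) + z (u - v) = 0.
    by rewrite scalerBr linearB addrACA -opprD e subrr.
  apply/eqP; rewrite -subr_eq0; apply/eqP.
  have [n] := zn (u - v); move: (u - v) e0 => {u v e} w.
  elim: n w => [//|n IH] w e0; rewrite iterSr => zn0.
  move: (e0); rewrite (IH (z w)) //; last by rewrite -linearZZ -linearD e0 linear0.
  by rewrite addr0 => /eqP; rewrite scaler_eq0 (negPf a0) => /eqP.
have [n] := zn v; elim: n v => [|n IH] v.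
  by move=> /= ->; exists 0; rewrite scaler0 linear0 addr0.
rewrite iterSr => /IH[w wP]; exists (a^-1 *: (v - w)).
rewrite scalerA mulfV // scale1r linearZZ linearB -wP.
by rewrite addrK scalerA mulVf // scale1r subrK.
Qed.

Lemma locally_nilpotent_scale V (z : {linear V -> V}) (b : k) :
  locally_nilpotent z -> locally_nilpotent (b \*: z).
Proof.
move=> zn v; have [n zv] := zn v; exists n.
suff -> : iter n (b \*: z) v = b ^+ n *: iter n z v by rewrite zv scaler0.
by elim: n {zv} => [|n IH]; rewrite ?scale1r //= IH linearZZ scalerA exprS.
Qed.

Lemma locally_nilpotent_one_sub_bijective V (z : {linear V -> V}) (b : k) :
  locally_nilpotent z -> bijective (fun v => v - b *: z v).
Proof.
move=> /(locally_nilpotent_scale (- b)).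
move=> /(locally_nilpotent_add_bijective (oner_neq0 k))/eq_bij; apply=> v /=.
by rewrite scale1r scaleNr.
Qed.
End LinearMaps.

(** * Direct sums *)

Section DirectSum.
Variables (k : fieldType) (I : choiceType) (V : I -> lmodType k).

Definition dsum_coord i (x : dsum V) : V i := dsum_val x i.
Arguments dsum_coord : simpl never.
Fact dsum_coord_linear i : linear (@dsum_coord i). Proof. by []. Qed.
HB.instance Definition _ i := GRing.isLinear.Build k (dsum V) (V i) _
  (@dsum_coord i) (@dsum_coord_linear i).

Lemma dsum_ext (x y : dsum V) :
  (forall i, dsum_coord i x = dsum_coord i y) -> x = y.
Proof. by move=> e; apply/val_inj/functional_extensionality_dep. Qed.

Lemma dsum_supp (x : dsum V) : exists2 r : seq I, uniq r &
  forall i, i \notin r -> dsum_coord i x = 0.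
Proof.
case: x => x /= xf; have /asboolP/finite_seqP[r e] := xf.
exists (undup r); first exact: undup_uniq.
move=> i; rewrite mem_undup => ir; apply: contrapT => /eqP xi.
have : [set i | x i != 0] i by [].
by rewrite e /= (negPf ir).
Qed.

Fact dsum_in_subproof i (x : V i) : dfwith (fun j => 0 : V j) x \in @finsupp k I V.
Proof.
apply/asboolP/(sub_finite_set (B := [set i])); last exact: finite_set1.
by move=> j; apply: contraPP => /= ij; rewrite dfwith_out ?eqxx //; apply/eqP => ij'; exact: ij.
Qed.
Definition dsum_in i (x : V i) : dsum V := Dsum (dsum_in_subproof x).
Arguments dsum_in : simpl never.

Lemma dsum_in_id i (x : V i) : dsum_coord i (dsum_in x) = x.
Proof. by rewrite /dsum_coord /= dfwith_in. Qed.
Lemma dsum_in_out i j (x : V i) : i != j -> dsum_coord j (dsum_in x) = 0.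
Proof. by move=> ij; rewrite /dsum_coord /= dfwith_out. Qed.

Fact dsum_in_linear i : linear (@dsum_in i).
Proof.
move=> a x y; apply: dsum_ext => j; rewrite linearP /=.
have [<-|ij] := eqVneq i j; first by rewrite !dsum_in_id.
by rewrite !dsum_in_out // scaler0 addr0.
Qed.
HB.instance Definition _ i := GRing.isLinear.Build k (V i) (dsum V) _
  (@dsum_in i) (@dsum_in_linear i).

Lemma dsum_sumE (x : dsum V) (r : seq I) : uniq r ->
  (forall i, i \notin r -> dsum_coord i x = 0) -> x = \sum_(i <- r) dsum_in (dsum_coord i x).
Proof.
move=> ru rx; apply: dsum_ext => i; rewrite linear_sum /=.
have [ir|ir] := boolP (i \in r).
  rewrite (bigD1_seq i) //= dsum_in_id big1 ?addr0 // => j ji.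
  by rewrite dsum_in_out.
rewrite rx // big_seq big1 // => j jr; rewrite dsum_in_out //.
by apply: contraNneq ir => <-.
Qed.

Lemma dsum_ind (P : dsum V -> Prop) : P 0 ->
  (forall x y, P x -> P y -> P (x + y)) -> (forall i x, P (@dsum_in i x)) ->
  forall x, P x.
Proof.
move=> P0 PD Pin x; have [r ru rx] := dsum_supp x.
by rewrite (dsum_sumE ru rx); apply: big_ind.
Qed.

Section Lift.
Variables (W : lmodType k) (u : forall i, {linear V i -> W}).

Definition dsum_lift (x : dsum V) : W := \sum_(i \in [set: I]) u i (dsum_coord i x).

Lemma dsum_liftE (x : dsum V) (r : seq I) : uniq r ->
  (forall i, i \notin r -> dsum_coord i x = 0) -> dsum_lift x = \sum_(i <- r) u i (dsum_coord i
      x).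
Proof.
move=> ru rx; rewrite /dsum_lift (fsbigE r) //.
  by apply: eq_bigl => i; rewrite in_setT.
by move=> i _ ir; rewrite rx // linear0.
Qed.

Fact dsum_lift_linear : linear dsum_lift.
Proof.
move=> a x y; have [r ru rx] := dsum_supp x; have [s su sy] := dsum_supp y.
have tu := undup_uniq (r ++ s); set t := undup _ in tu.
have tP i : i \notin t -> (dsum_coord i x = 0) * (dsum_coord i y = 0).
  by rewrite mem_undup mem_cat negb_or => /andP[/rx -> /sy ->].
rewrite (dsum_liftE (x := x) tu) => [|i /tP[]//].
rewrite (dsum_liftE (x := y) tu) => [|i /tP[]//].
rewrite (dsum_liftE (x := a *: x + y) tu) => [|i /tP[xi yi]].
  rewrite scaler_sumr -big_split /=; apply: eq_bigr => i _.
  by rewrite -linearP.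
by rewrite linearP /= xi yi scaler0 addr0.
Qed.
HB.instance Definition _ := GRing.isLinear.Build k (dsum V) W _
  dsum_lift dsum_lift_linear.

Lemma dsum_lift_in i x : dsum_lift (@dsum_in i x) = u i x.
Proof.
rewrite (dsum_liftE (r := [:: i])) // => [|j].
  by rewrite big_seq1 dsum_in_id.
by rewrite inE => ji; rewrite dsum_in_out // eq_sym.
Qed.
End Lift.

Lemma dsum_linear_ext (W : lmodType k) (f g : {linear dsum V -> W}) :
  (forall i x, f (@dsum_in i x) = g (dsum_in x)) -> forall x, f x = g x.
Proof.
move=> e; apply: dsum_ind => [|x y ex ey|//]; first by rewrite !linear0.
by rewrite !linearD ex ey.
Qed.
End DirectSum.
Arguments dsum_in {k I V} i x : simpl never.
Arguments dsum_coord {k I V} i x : simpl never.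
Arguments dsum_lift {k I V W} u x : simpl never.

Lemma dsum_map_in (k : fieldType) (I : choiceType) (V W : I -> lmodType k)
   (f : forall i, {linear V i -> W i}) i x :
  dsum_map f (dsum_in i x) = dsum_in i (f i x).
Proof.
apply: dsum_ext => j; rewrite -[LHS]/(f j (dsum_coord j (dsum_in i x))).
have [<-|ij] := eqVneq i j; first by rewrite !dsum_in_id.
by rewrite !dsum_in_out // linear0.
Qed.

(** * Partial fractions *)

Definition fseq (k : fieldType) (W : lmodType k) : lmodType k := dsum (fun _ : nat => W).

Section FinitelySupported.
Variables (k : fieldType) (W : lmodType k).
Definition fmonom j (x : W) : fseq W := @dsum_in k nat (fun _ => W) j x.
HB.instance Definition _ j :=
  GRing.Linear.copy (fmonom j) (@dsum_in k nat (fun _ => W) j).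
Definition fcoef j (v : fseq W) : W := @dsum_coord k nat (fun _ => W) j v.
HB.instance Definition _ j :=
  GRing.Linear.copy (fcoef j) (@dsum_coord k nat (fun _ => W) j).

Definition shift_up (v : fseq W) : fseq W :=
  dsum_lift (V := fun _ : nat => W) (fun n => fmonom n.+1 : {linear _ -> _}) v.
HB.instance Definition _ := GRing.Linear.copy shift_up (dsum_lift _).
Definition shift_down (v : fseq W) : fseq W :=
  dsum_lift (V := fun _ : nat => W)
    (fun n => if n is n'.+1 then fmonom n' : {linear _ -> _} else \0) v.
HB.instance Definition _ := GRing.Linear.copy shift_down (dsum_lift _).
Arguments fmonom : simpl never.
Arguments fcoef : simpl never.
Arguments shift_up : simpl never.
Arguments shift_down : simpl never.

Lemma fcoef_fmonom i j x : fcoef i (fmonom j x) = if i == j then x else 0.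
Proof.
have [->|ij] := eqVneq; first exact: dsum_in_id.
by apply: dsum_in_out; rewrite eq_sym.
Qed.

Lemma fseq_ext (x y : fseq W) : (forall j, fcoef j x = fcoef j y) -> x = y.
Proof. exact: dsum_ext. Qed.

Lemma fseq_linear_ext (U : lmodType k) (f g : {linear fseq W -> U}) :
  (forall j x, f (fmonom j x) = g (fmonom j x)) -> forall x, f x = g x.
Proof. exact: dsum_linear_ext. Qed.

Lemma shift_up_fmonom j x : shift_up (fmonom j x) = fmonom j.+1 x.
Proof. exact: dsum_lift_in. Qed.
Lemma shift_down_fmonom0 x : shift_down (fmonom 0 x) = 0.
Proof. exact: dsum_lift_in. Qed.
Lemma shift_down_fmonomS j x : shift_down (fmonom j.+1 x) = fmonom j x.
Proof. exact: dsum_lift_in. Qed.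

Lemma fcoef0_shift_up v : fcoef 0 (shift_up v) = 0.
Proof.
apply: (fseq_linear_ext (f := fcoef 0 \o shift_up) (g := \0)) => i x /=.
by rewrite shift_up_fmonom fcoef_fmonom.
Qed.

Lemma fcoefS_shift_up j v : fcoef j.+1 (shift_up v) = fcoef j v.
Proof.
apply: (fseq_linear_ext (f := fcoef j.+1 \o shift_up) (g := fcoef j)) => i x /=.
by rewrite shift_up_fmonom !fcoef_fmonom eqSS.
Qed.

Lemma fcoef_shift_down j v : fcoef j (shift_down v) = fcoef j.+1 v.
Proof.
apply: (fseq_linear_ext (f := fcoef j \o shift_down) (g := fcoef j.+1)) => i x /=.
by case: i => [|i]; rewrite ?shift_down_fmonom0 ?shift_down_fmonomS ?linear0 // !fcoef_fmonom.
Qed.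

Lemma shift_upK : cancel shift_up shift_down.
Proof. by move=> v; apply: fseq_ext => j; rewrite fcoef_shift_down fcoefS_shift_up. Qed.

Lemma shift_decomp v : v = shift_up (shift_down v) + fmonom 0 (fcoef 0 v).
Proof.
apply: fseq_ext => -[|j]; rewrite linearD /= fcoef_fmonom.
  by rewrite fcoef0_shift_up add0r.
by rewrite fcoefS_shift_up fcoef_shift_down addr0.
Qed.

Lemma fcoef_iter_shift_down n j v : fcoef j (iter n shift_down v) = fcoef (j + n)%N v.
Proof.
elim: n j => [|n IH] j /=; first by rewrite addn0.
by rewrite fcoef_shift_down IH addSnnS.
Qed.

Lemma fcoef_bound (v : fseq W) : exists n, forall j, (n <= j)%N -> fcoef j v = 0.
Proof.
have [r _ rv] := dsum_supp v; exists (\max_(i <- r) i.+1)%N => j jr; apply: rv.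
by apply/negP => /(leq_bigmax_seq (F := S)) /(_ isT); rewrite leqNgt ltnS jr.
Qed.

Lemma shift_down_locally_nilpotent : locally_nilpotent shift_down.
Proof.
move=> v; have [n nP] := fcoef_bound v; exists n; apply: fseq_ext => j.
by rewrite fcoef_iter_shift_down nP ?leq_addl // linear0.
Qed.
End FinitelySupported.
Arguments fmonom {k W} j x : simpl never.
Arguments fcoef {k W} j v : simpl never.
Arguments shift_up {k W} v : simpl never.
Arguments shift_down {k W} v : simpl never.

Section PartialFractions.
Variables (k : fieldType) (W : lmodType k).

(** This is [W * A] for the ring [A] of rational functions with poles at arbitrary points.
    At a finite point [Some c] the [j]-th coefficient is that of [(x - c)^-(j + 1)], and at
    [None] it is that of [x^j]. *)
Definition pfrac : lmodType k := dsum (fun _ : P1 k => fseq W).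
Definition pf_in l (v : fseq W) : pfrac := @dsum_in k (option k) (fun _ => fseq W) l v.
HB.instance Definition _ l :=
  GRing.Linear.copy (pf_in l) (@dsum_in k (option k) (fun _ => fseq W) l).
Definition pf_part l (x : pfrac) : fseq W := @dsum_coord k (option k) (fun _ => fseq W) l x.
HB.instance Definition _ l :=
  GRing.Linear.copy (pf_part l) (@dsum_coord k (option k) (fun _ => fseq W) l).
Arguments pf_in : simpl never.
Arguments pf_part : simpl never.

Lemma pf_part_in l m v : pf_part l (pf_in m v) = if l == m then v else 0.
Proof.
have [->|ij] := eqVneq; first exact: dsum_in_id.
by apply: dsum_in_out; rewrite eq_sym.
Qed.
Lemma pfrac_ext (x y : pfrac) : (forall l, pf_part l x = pf_part l y) -> x = y.
Proof. exact: dsum_ext. Qed.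
Lemma pfrac_linear_ext (U : lmodType k) (f g : {linear pfrac -> U}) :
  (forall l x, f (pf_in l x) = g (pf_in l x)) -> forall x, f x = g x.
Proof. exact: (@dsum_linear_ext k (option k) (fun _ => fseq W)). Qed.
Definition pf_lift (U : lmodType k) (u : P1 k -> {linear fseq W -> U}) (x : pfrac) : U :=
  @dsum_lift k (option k) (fun _ => fseq W) U u x.
HB.instance Definition _ U u :=
  GRing.Linear.copy (@pf_lift U u) (@dsum_lift k (option k) (fun _ => fseq W) U u).
Arguments pf_lift : simpl never.
Lemma pf_lift_in U u l v : @pf_lift U u (pf_in l v) = u l v.
Proof. exact: (@dsum_lift_in k (option k) (fun _ => fseq W)). Qed.

Lemma pf_liftE (U : lmodType k) (u : P1 k -> {linear fseq W -> U}) (x : pfrac)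
    (r : seq (option k)) : uniq r ->
  (forall l, l \notin r -> pf_part l x = 0) ->
  pf_lift u x = \sum_(l <- r) u l (pf_part l x).
Proof. exact: (@dsum_liftE k (option k) (fun _ => fseq W)). Qed.

(** Multiplication by [x] up to constants: [x (x - c)^-1 = 1 + c (x - c)^-1] contributes a
    1 that belongs to the part at infinity, which [pf_mulx] adds. *)
Definition pf_mul_part (l : P1 k) (v : fseq W) : fseq W :=
  if l is Some c then c *: v + shift_down v else shift_up v.
Fact pf_mul_part_linear l : linear (pf_mul_part l).
Proof.
case: l => [c|] a u v /=; last exact: linearP.
exact: (linearP ((c \*: idfun) \+ shift_down)).
Qed.
HB.instance Definition _ l := GRing.isLinear.Build k (fseq W) (fseq W) _
  (pf_mul_part l) (pf_mul_part_linear l).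

Definition pf_const (w : W) : pfrac := pf_in None (fmonom 0 w).
HB.instance Definition _ := GRing.Linear.copy pf_const (pf_in None \o fmonom 0).
Arguments pf_const : simpl never.

(** The sum of the residues at the finite points. *)
Definition pf_residue (x : pfrac) : W :=
  pf_lift (fun l => if l is Some _ then fcoef 0 : {linear _ -> _} else \0) x.
HB.instance Definition _ := GRing.Linear.copy pf_residue (pf_lift _).
Arguments pf_residue : simpl never.

Definition pf_mulx (x : pfrac) : pfrac :=
  pf_lift (fun l => pf_in l \o pf_mul_part l) x + pf_const (pf_residue x).
HB.instance Definition _ := GRing.Linear.copy pf_mulx
  (pf_lift (fun l => pf_in l \o pf_mul_part l) \+ (pf_const \o pf_residue)).
Arguments pf_mulx : simpl never.

(** A lift, so that it can be summed over the same points as [pf_residue]. *)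
Definition pf_const_coef (x : pfrac) : W :=
  pf_lift (fun l => if l is Some _ then \0 else fcoef 0 : {linear _ -> _}) x.
HB.instance Definition _ := GRing.Linear.copy pf_const_coef (pf_lift _).

Lemma pf_const_coefE x : pf_const_coef x = fcoef 0 (pf_part None x).
Proof.
apply: (pfrac_linear_ext (f := pf_const_coef) (g := fcoef 0 \o pf_part None)) => l v /=.
rewrite /pf_const_coef pf_lift_in pf_part_in.
by case: l => [c|] //=; rewrite linear0.
Qed.

Lemma pf_mulx_in_fin c v :
  pf_mulx (pf_in (Some c) v) = pf_in (Some c) (c *: v + shift_down v) + pf_const (fcoef 0 v).
Proof. by rewrite /pf_mulx /= pf_lift_in /pf_residue pf_lift_in. Qed.
Lemma pf_mulx_in_inf v : pf_mulx (pf_in None v) = pf_in None (shift_up v).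
Proof. by rewrite /pf_mulx /= pf_lift_in /pf_residue pf_lift_in /= linear0 addr0. Qed.

Lemma pf_part_mulx_fin c x :
  pf_part (Some c) (pf_mulx x) = c *: pf_part (Some c) x + shift_down (pf_part (Some c) x).
Proof.
apply: (pfrac_linear_ext (f := pf_part (Some c) \o pf_mulx)
  (g := ((c \*: idfun) \+ shift_down) \o pf_part (Some c))) => -[d|] v /=.
  rewrite pf_mulx_in_fin linearD /= !pf_part_in addr0.
  by case: eqP => [[->]//|_]; rewrite scaler0 linear0 addr0.
by rewrite pf_mulx_in_inf !pf_part_in /= scaler0 linear0 addr0.
Qed.

Lemma pf_part_mulx_inf x :
  pf_part None (pf_mulx x) = shift_up (pf_part None x) + fmonom 0 (pf_residue x).
Proof.
apply: (pfrac_linear_ext (f := pf_part None \o pf_mulx)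
  (g := (shift_up \o pf_part None) \+ (fmonom 0 \o pf_residue))) => -[d|] v /=.
  by rewrite pf_mulx_in_fin linearD /= !pf_part_in /= linear0 /pf_residue pf_lift_in.
by rewrite pf_mulx_in_inf !pf_part_in /= /pf_residue pf_lift_in /= linear0 addr0.
Qed.

(** This makes [W * A] invertible at every finite point.  On the part at a point [d]
    other than [c], [x - c] is a nonzero scalar plus a locally nilpotent shift, up to
    constants; on the part at [c] it is the shift, whose kernel [(x - c)^-1] is the
    element that [x - c] maps to 1; and at infinity dividing by [x - c] leaves a
    constant remainder, which is hit by that element. *)
Lemma pf_mulx_sub_bijective (c : k) : bijective (pf_mulx \- c \*: idfun).
Proof.
pose L : {linear pfrac -> pfrac} := pf_mulx \- c \*: idfun.
apply: (inj_surj_bijective (f := L)); last first.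
  pose P w := exists v, L v = w.
  have PD w w' : P w -> P w' -> P (w + w').
    by move=> [v <-] [v' <-]; exists (v + v'); rewrite linearD.
  have PB w w' : P (w + w') -> P w' -> P w.
    by move=> [v e] [v' e']; exists (v - v'); rewrite linearB e e' addrK.
  have Pinf d : P (pf_in None d).
    have [u uP] : exists u, u - c *: shift_down u = shift_down d.
      have [g _ gK] := locally_nilpotent_one_sub_bijective c
         (@shift_down_locally_nilpotent k W).
      by exists (g (shift_down d)); exact: gK.
    (* [u] is the quotient of [d] by [x - c], and [y] the remainder. *)
    pose y := d + c *: u - shift_up u.
    have yE : y = fmonom 0 (fcoef 0 y).
      have y0 : shift_down y = 0.
        by rewrite /y linearB linearD linearZZ /= shift_upK -uP subrK subrr.
      by rewrite {1}[y]shift_decomp y0 linear0 add0r.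
    have dE : d = shift_up u - c *: u + fmonom 0 (fcoef 0 y).
      by rewrite -yE /y [RHS]addrC addrA subrK addrK.
    move: (fcoef 0 y) dE => a ->; exists (pf_in None u + pf_in (Some c) (fmonom 0 a)).
    rewrite linearD /L /= pf_mulx_in_fin pf_mulx_in_inf shift_down_fmonom0 addr0.
    rewrite fcoef_fmonom /= [pf_in (Some c) _]linearZZ [_ + pf_const a]addrC addrK.
    rewrite [RHS]linearD /= [pf_in None (_ - _)]linearB /=.
    by rewrite [pf_in None (_ *: _)]linearZZ.
  apply: dsum_ind => [||[d|] v]; first by exists 0; rewrite linear0.
    exact: PD.
  2: exact: Pinf.
  have [->|dc] := eqVneq d c.
    exists (pf_in (Some c) (shift_up v)); rewrite /L /= pf_mulx_in_fin.
    rewrite fcoef0_shift_up linear0 addr0 linearD addrAC linearZZ subrr add0r.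
    by rewrite shift_upK.
  have dc0 : d - c != 0 by rewrite subr_eq0.
  have [g gK gK'] := locally_nilpotent_add_bijective dc0
     (@shift_down_locally_nilpotent k W).
  have [u <-] : exists u, (d - c) *: u + shift_down u = v by exists (g v).
  apply: (PB _ (pf_const (fcoef 0 u))); last exact: Pinf.
  exists (pf_in (Some d) u); rewrite /L /= pf_mulx_in_fin addrAC; congr (_ + _).
  by rewrite -[c *: _]linearZZ -linearB /= scalerBl [in RHS]addrAC.
apply: (raddf_inj (f := L)) => x Lx.
have e l : pf_part l (pf_mulx x) = c *: pf_part l x.
  by apply/eqP; rewrite -subr_eq0 -linearZZ -linearB -[pf_mulx x - _]/(L x) Lx linear0.
have x_inf : pf_part None x = 0.
  have e1 : pf_part None x = c *: shift_down (pf_part None x).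
    rewrite -linearZZ -e pf_part_mulx_inf linearD /= shift_down_fmonom0 addr0.
    by rewrite shift_upK.
  apply: (bij_inj (locally_nilpotent_one_sub_bijective c
    (@shift_down_locally_nilpotent k W))).
  by rewrite linear0 -e1 scaler0 subr0 subrr.
have x_fin d : d != c -> pf_part (Some d) x = 0.
  move=> dc; have dc0 : d - c != 0 by rewrite subr_eq0.
  apply: (bij_inj (locally_nilpotent_add_bijective dc0
    (@shift_down_locally_nilpotent k W))) => /=.
  rewrite scaler0 linear0 addr0 scalerBl addrAC -pf_part_mulx_fin e subrr //.
have x_c : shift_down (pf_part (Some c) x) = 0.
  by have := e (Some c); rewrite pf_part_mulx_fin => /(canRL (addKr _)); rewrite addNr.
have res0 : pf_residue x = 0.
  have := e None; rewrite x_inf scaler0 pf_part_mulx_inf x_inf linear0 add0r.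
  by move=> /(congr1 (fcoef 0)); rewrite fcoef_fmonom linear0.
have xE : x = pf_in (Some c) (pf_part (Some c) x).
  apply: pfrac_ext => -[d|]; rewrite pf_part_in //; case: eqP => [[->] //|dc].
  by apply: x_fin; apply/eqP => dc'; apply: dc; rewrite dc'.
have coef_c : fcoef 0 (pf_part (Some c) x) = 0.
  by move: res0; rewrite {1}xE /pf_residue pf_lift_in.
by rewrite xE [pf_part (Some c) x]shift_decomp x_c coef_c !linear0 addr0 linear0.
Qed.
End PartialFractions.
Arguments pf_in {k W} l v : simpl never.
Arguments pf_part {k W} l x : simpl never.
Arguments pf_lift {k W U} u x : simpl never.
Arguments pf_const {k W} w : simpl never.
Arguments pf_residue {k W} x : simpl never.
Arguments pf_mulx {k W} x : simpl never.

(** * Hom and Ext of Kronecker representations *)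

Section Kron.
Variable k : fieldType.
Implicit Types (l : P1 k) (M V C : krep k).

Definition kF l V : {linear kv1 V -> kv2 V} := if l is Some _ then kf V else kg V.
Definition kG l V : {linear kv1 V -> kv2 V} :=
  if l is Some c then kg V \- c \*: kf V else kf V.

Lemma invertible_onP X V :
  invertible_on X V <-> forall l, X l -> bijective (kG l V).
Proof.
split=> [[Vf Vg] [c|] Xl|VG]; [exact: Vf|exact: Vg|].
by split=> [c|]; [apply: (VG (Some c))|apply: (VG None)].
Qed.

Lemma invertible_on1 l V : invertible_on [set l] V <-> bijective (kG l V).
Proof. by rewrite invertible_onP; split=> [|VG m ->//]; apply. Qed.

Lemma khF l V W (h : khom V W) v : kF l W (kh1 h v) = kh2 h (kF l V v).
Proof. by case: l => [c|] /=; rewrite ?khf ?khg. Qed.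

Lemma khG l V W (h : khom V W) v : kG l W (kh1 h v) = kh2 h (kG l V v).
Proof. by case: l => [c|] /=; rewrite khf ?khg ?linearBZ. Qed.

Section HomFG.
Variables (l : P1 k) (V W : krep k).
Variables (h1 : {linear kv1 V -> kv1 W}) (h2 : {linear kv2 V -> kv2 W}).
Hypothesis hF : forall v, kF l W (h1 v) = h2 (kF l V v).
Hypothesis hG : forall v, kG l W (h1 v) = h2 (kG l V v).

Fact khom_of_f v : kf W (h1 v) = h2 (kf V v).
Proof. by case: l hF hG. Qed.
Fact khom_of_g v : kg W (h1 v) = h2 (kg V v).
Proof.
case: l hF hG => [c|//] /= hf hg; move: (hg v).
by rewrite linearBZ hf; apply: addIr.
Qed.
Definition khom_of : khom V W := Khom khom_of_f khom_of_g.
End HomFG.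

Lemma Hom_zeroP M V :
  Hom_zero M V <-> forall h : khom M V, (forall m, kh1 h m = 0) /\ (forall m, kh2 h m = 0).
Proof.
split=> [H h|H h]; first by rewrite (H h).
by have [? ?] := H h; apply: khom_ext.
Qed.

Lemma kisoP V W (h : khom V W) :
  kiso h <-> bijective (kh1 h) /\ bijective (kh2 h).
Proof.
split=> [[g [gh hg]]|[/bijective_linear_inv[g1 [g1K K1]] /bijective_linear_inv[g2 [g2K K2]]]].
  split; [exists (kh1 g)|exists (kh2 g)] => v.
  - by have /= := congr1 (fun f : khom V V => kh1 f v) gh.
  - by have /= := congr1 (fun f : khom W W => kh1 f v) hg.
  - by have /= := congr1 (fun f : khom V V => kh2 f v) gh.
  - by have /= := congr1 (fun f : khom W W => kh2 f v) hg.
have gf v : kf V (g1 v) = g2 (kf W v) by rewrite -{2}[v]K1 khf g2K.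
have gg v : kg V (g1 v) = g2 (kg W v) by rewrite -{2}[v]K1 khg g2K.
by exists (Khom gf gg); split; apply: khom_ext => v /=.
Qed.

Lemma short_exactP (A B C : lmodType k) (i : {linear A -> B}) (p : {linear B -> C}) :
  short_exact i p <-> [/\ injective i, forall c, exists b, p b = c,
    forall a, p (i a) = 0 & forall b, p b = 0 -> exists a, i a = b].
Proof.
split=> [[ii ps ip]|[ii ps pi0 p0]]; split=> //.
- move=> c; have [b _ <-] : range p c by rewrite ps.
  by exists b.
- move=> a; have : range i (i a) by exists a.
  by rewrite ip.
- move=> b pb; have [a _ <-] : range i b by rewrite ip.
  by exists a.
- by rewrite predeqE => c; split=> // _; have [b <-] := ps c; exists b.
- rewrite predeqE => b; split=> [[a _ <-]|/= /p0[a <-]]; first exact: pi0.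
  by exists a.
Qed.

Definition Ext_solvable M V := forall a b : {linear kv1 M -> kv2 V},
  exists (h1 : {linear kv1 M -> kv1 V}) (h2 : {linear kv2 M -> kv2 V}),
  forall m, kf V (h1 m) - h2 (kf M m) = a m /\ kg V (h1 m) - h2 (kg M m) = b m.

(** Given [a] and [b], the structure maps [(f, a; 0, f)] and [(g, b; 0, g)] on the sum of
    [V] and [M] define an extension; a splitting of it is a solution. *)
Lemma Ext1_zero_solvable M V : Ext1_zero M V -> Ext_solvable M V.
Proof.
move=> H a b.
pose ext (x : {linear kv1 M -> kv2 V}) (f : {linear kv1 V -> kv2 V})
  (f' : {linear kv1 M -> kv2 M}) (v : kv1 V * kv1 M) := (f v.1 + x v.2, f' v.2).
have extL x f f' : linear (ext x f f').
  move=> c u v; congr pair; last exact: linearP.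
  by rewrite /= !linearP scalerDr addrACA.
pose E := Krep (build_linear (extL a (kf V) (kf M))) (build_linear (extL b (kg V) (kg M))).
have iP (x : {linear kv1 M -> kv2 V}) (f : {linear kv1 V -> kv2 V})
    (f' : {linear kv1 M -> kv2 M}) v :
    ext x f f' (pair_inl (kv1 M) v) = pair_inl (kv2 M) (f v).
  by rewrite /ext /pair_inl /= !linear0 addr0.
pose i := @Khom k V E (@pair_inl k _ _) (@pair_inl k _ _) (iP _ _ _) (iP _ _ _).
pose p := @Khom k E M (@pair_snd k _ _) (@pair_snd k _ _) (fun=> erefl) (fun=> erefl).
have [h [_ hi ph]] := H (@Extension k M V E i p (short_exact_pair _ _) (short_exact_pair _ _)).
have h1i v : kh1 h (v, 0) = (v, 0) by have /= := congr1 (fun g => kh1 g v) hi.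
have h2i v : kh2 h (v, 0) = (v, 0) by have /= := congr1 (fun g => kh2 g v) hi.
have h1p x : (kh1 h x).2 = x.2 by have /= := congr1 (fun g => kh1 g x) ph.
have h2p x : (kh2 h x).2 = x.2 by have /= := congr1 (fun g => kh2 g x) ph.
have s1L : linear (fun m => (kh1 h (0, m)).1).
  move=> c u v /=.
  have -> : (0, c *: u + v) = c *: (0, u) + (0, v) :> kv1 V * kv1 M.
    by congr pair; rewrite /= scaler0 addr0.
  by rewrite linearP.
have s2L : linear (fun m => (kh2 h (0, m)).1).
  move=> c u v /=.
  have -> : (0, c *: u + v) = c *: (0, u) + (0, v) :> kv2 V * kv2 M.
    by congr pair; rewrite /= scaler0 addr0.
  by rewrite linearP.
have h2E v m : (kh2 h (v, m)).1 = v + (kh2 h (0, m)).1.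
  have -> : (v, m) = (v, 0) + (0, m) :> kv2 V * kv2 M.
    by congr pair; rewrite /= ?addr0 ?add0r.
  by rewrite linearD h2i.
exists (build_linear s1L), (build_linear s2L) => m /=; split.
- have /(congr1 fst) /= := khf h (0, m).
  by rewrite /ext /= linear0 add0r h2E => ->; rewrite addrK.
- have /(congr1 fst) /= := khg h (0, m).
  by rewrite /ext /= linear0 add0r h2E => ->; rewrite addrK.
Qed.

(** Linear sections [s1], [s2] of an extension fail to commute with the structure maps by
    maps [a] and [b] into [V]; a solution for [a] and [b] corrects the sections. *)
Lemma Ext_solvable_zero M V : Ext_solvable M V -> Ext1_zero M V.
Proof.
move=> H [E i p se1 se2].
have [i1I p1S p1i ker1] := (short_exactP _ _).1 se1.
have [i2I p2S p2i ker2] := (short_exactP _ _).1 se2.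
have [s1 s1K] := surj_linear_section p1S.
have [s2 s2K] := surj_linear_section p2S.
have defect (f : {linear kv1 E -> kv2 E}) (fM : {linear kv1 M -> kv2 M}) :
    (forall x, fM (kh1 p x) = kh2 p (f x)) ->
    exists a : {linear kv1 M -> kv2 V}, forall m, kh2 i (a m) = s2 (fM m) - f (s1 m).
  move=> fp.
  have /choice[a aP] : forall m, exists v, kh2 i v = s2 (fM m) - f (s1 m).
    by move=> m; apply: ker2; rewrite linearB s2K -fp s1K subrr.
  have aL : linear a.
    move=> c u v; apply: i2I; rewrite linearP /= !aP [fM _]linearP [s1 _]linearP /=.
    rewrite [s2 _]linearP [f _]linearP /=.
    by rewrite scalerBr opprD addrACA.
  by exists (build_linear aL).
have [a aP] := defect (kf E) (kf M) (khf p).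
have [b bP] := defect (kg E) (kg M) (khg p).
have [h1 [h2 hP]] := H a b.
pose t1 : {linear kv1 M -> kv1 E} := s1 \+ (kh1 i \o h1).
pose t2 : {linear kv2 M -> kv2 E} := s2 \+ (kh2 i \o h2).
have tf m : kf E (t1 m) = t2 (kf M m).
  rewrite /t1 /t2 /= linearD khf -[kf V _](subrK (h2 (kf M m))) (hP m).1 linearD aP.
  by rewrite addrA [kf E _ + _]addrC subrK.
have tg m : kg E (t1 m) = t2 (kg M m).
  rewrite /t1 /t2 /= linearD khg -[kg V _](subrK (h2 (kg M m))) (hP m).2 linearD bP.
  by rewrite addrA [kg E _ + _]addrC subrK.
have t1K m : kh1 p (t1 m) = m by rewrite /t1 linearD /= s1K p1i addr0.
have t2K m : kh2 p (t2 m) = m by rewrite /t2 linearD /= s2K p2i addr0.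
have /choice[r1 r1P] x : exists v, kh1 i v = x - t1 (kh1 p x).
  by apply: ker1; rewrite linearB t1K subrr.
have /choice[r2 r2P] x : exists v, kh2 i v = x - t2 (kh2 p x).
  by apply: ker2; rewrite linearB t2K subrr.
have q1L : linear (fun x => (r1 x, kh1 p x)).
  move=> c x y; congr pair; rewrite ?linearP //; apply: i1I.
  rewrite linearP /= !r1P [kh1 p _]linearP [t1 _]linearP /=.
  by rewrite scalerBr opprD addrACA.
have q2L : linear (fun x => (r2 x, kh2 p x)).
  move=> c x y; congr pair; rewrite ?linearP //; apply: i2I.
  rewrite linearP /= !r2P [kh2 p _]linearP [t2 _]linearP /=.
  by rewrite scalerBr opprD addrACA.
have qf x : kf (ksum2 V M) (build_linear q1L x) = build_linear q2L (kf E x).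
  congr pair; last exact: khf.
  by apply: i2I; rewrite /= -khf r1P r2P linearB tf khf.
have qg x : kg (ksum2 V M) (build_linear q1L x) = build_linear q2L (kg E x).
  congr pair; last exact: khg.
  by apply: i2I; rewrite /= -khg r1P r2P linearB tg khg.
exists (@Khom k E (ksum2 V M) (build_linear q1L) (build_linear q2L) qf qg); split.
- apply/kisoP; split=> /=.
    exists (fun x => kh1 i x.1 + t1 x.2) => [x|[v m]] /=; first by rewrite r1P subrK.
    congr pair; last by rewrite linearD t1K p1i add0r.
    by apply: i1I; rewrite r1P [kh1 p _]linearD /= p1i t1K add0r addrK.
  exists (fun x => kh2 i x.1 + t2 x.2) => [x|[v m]] /=; first by rewrite r2P subrK.
  congr pair; last by rewrite linearD t2K p2i add0r.
  by apply: i2I; rewrite r2P [kh2 p _]linearD /= p2i t2K add0r addrK.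
- apply: khom_ext => v; (congr pair; last by rewrite /= ?p1i ?p2i).
    by apply: i1I; rewrite /= r1P p1i linear0 subr0.
  by apply: i2I; rewrite /= r2P p2i linear0 subr0.
- by apply: khom_ext.
Qed.

Definition Ext_solvable_at l M V := forall a b : {linear kv1 M -> kv2 V},
  exists (h1 : {linear kv1 M -> kv1 V}) (h2 : {linear kv2 M -> kv2 V}),
  forall m, kF l V (h1 m) - h2 (kF l M m) = a m /\
            kG l V (h1 m) - h2 (kG l M m) = b m.

(** Both equations may be replaced by linear combinations of them, so the basis [F], [G]
    of the pencil at any point will do. *)
Lemma Ext1_zeroP l M V : Ext1_zero M V <-> Ext_solvable_at l M V.
Proof.
apply: (iff_trans (B := Ext_solvable M V)).
  by split; [exact: Ext1_zero_solvable|exact: Ext_solvable_zero].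
have subBZ (c : k) (x y z t : kv2 V) : x - c *: y - (z - c *: t) = x - z - c *: (y - t).
  by rewrite scalerBr !opprB addrACA [RHS]addrACA [- _ - _]addrC.
case: l => [c|]; split=> H a b.
- have [h1 [h2 hP]] := H a (b \+ c \*: a); exists h1, h2 => m; have [e1 e2] := hP m.
  by split=> //=; rewrite linearBZ subBZ e1 e2 addrK.
- have [h1 [h2 hP]] := H a (b \- c \*: a); exists h1, h2 => m; have [e1 e2] := hP m.
  by split=> //; move: e2 => /=; rewrite linearBZ subBZ e1 => /addIr.
- by have [h1 [h2 hP]] := H b a; exists h1, h2 => m; have [e1 e2] := hP m.
- by have [h1 [h2 hP]] := H b a; exists h1, h2 => m; have [e1 e2] := hP m.
Qed.
End Kron.

Section Points.
Variable k : fieldType.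
Implicit Types (l : P1 k) (M V C : krep k) (U W : lmodType k).

Definition fseq_map U W (f : {linear U -> W}) (v : fseq U) : fseq W := dsum_map (fun _ => f) v.
HB.instance Definition _ U W f := GRing.Linear.copy (@fseq_map U W f) (dsum_map _).
Arguments fseq_map : simpl never.
Lemma fcoef_map U W (f : {linear U -> W}) j v :
  fcoef j (fseq_map f v) = f (fcoef j v).
Proof. by []. Qed.
Lemma fseq_map_fmonom U W (f : {linear U -> W}) j x :
  fseq_map f (fmonom j x) = fmonom j (f x).
Proof. exact: dsum_map_in. Qed.
Lemma fseq_map_shift_up U W (f : {linear U -> W}) v :
  fseq_map f (shift_up v) = shift_up (fseq_map f v).
Proof.
apply: fseq_ext => -[|j]; rewrite fcoef_map ?fcoef0_shift_up ?linear0 //.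
by rewrite !fcoefS_shift_up fcoef_map.
Qed.

(** * Comodules and contramodules at one point *)

Definition pencil_rep l U W (F G : {linear U -> W}) : krep k :=
  @Krep k U W (if l is Some _ then F else G)
    (if l is Some c then G \+ c \*: F else F).

Lemma kF_pencil l U W (F G : {linear U -> W}) (v : U) :
  kF l (pencil_rep l F G) v = F v.
Proof. by case: l. Qed.
Lemma kG_pencil l U W (F G : {linear U -> W}) (v : U) :
  kG l (pencil_rep l F G) v = G v.
Proof. by case: l => [c|] //=; rewrite addrK. Qed.

Section KrepOf.
Variables (l : P1 k) (W : lmodType k) (y : {linear W -> W}).

(** The general representation invertible at [l], up to isomorphism. *)
Definition operator_rep : krep k := pencil_rep l y idfun.

Lemma operator_repF (v : W) : kF l operator_rep v = y v.
Proof. exact: kF_pencil. Qed.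
Lemma operator_repG (v : W) : kG l operator_rep v = v.
Proof. exact: kG_pencil. Qed.

Lemma Hom_zero_operator M : Hom_zero M operator_rep ->
  forall h : {linear kv2 M -> W}, (forall m, h (kF l M m) = y (h (kG l M m))) ->
  forall n, h n = 0.
Proof.
move=> /Hom_zeroP H h hP n.
pose h1 : {linear kv1 M -> kv1 operator_rep} := h \o kG l M.
pose h2 : {linear kv2 M -> kv2 operator_rep} := h.
have hF v : kF l operator_rep (h1 v) = h2 (kF l M v) by rewrite operator_repF hP.
have hG v : kG l operator_rep (h1 v) = h2 (kG l M v) by rewrite operator_repG.
exact: (H (khom_of hF hG)).2.
Qed.

Lemma Ext1_zero_operator M : Ext1_zero M operator_rep ->
  forall c : {linear kv1 M -> W}, exists h : {linear kv2 M -> W},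
  forall m, h (kF l M m) - y (h (kG l M m)) = c m.
Proof.
move=> /(Ext1_zeroP l) H c; have [h1 [h2 hP]] := H ((-1) \*: c) \0.
exists h2 => m; have [] := hP m; rewrite operator_repF operator_repG /= scaleN1r => e /eqP.
by rewrite subr_eq0 => /eqP <-; rewrite -[RHS]opprK -e opprB.
Qed.

Lemma Hom_zero_from_operator C : Hom_zero operator_rep C ->
  forall h : {linear W -> kv1 C}, (forall v, kF l C (h v) = kG l C (h (y v))) ->
  forall v, h v = 0.
Proof.
move=> /Hom_zeroP H h hP v.
pose h1 : {linear kv1 operator_rep -> kv1 C} := h.
pose h2 : {linear kv2 operator_rep -> kv2 C} := kG l C \o h.
have hF u : kF l C (h1 u) = h2 (kF l operator_rep u) by rewrite operator_repF hP.
have hG u : kG l C (h1 u) = h2 (kG l operator_rep u) by rewrite operator_repG.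
exact: (H (khom_of hF hG)).1.
Qed.

Lemma Ext1_zero_from_operator C : Ext1_zero operator_rep C ->
  forall c : {linear W -> kv2 C}, exists h : {linear W -> kv1 C},
  forall v, kF l C (h v) - kG l C (h (y v)) = c v.
Proof.
move=> /(Ext1_zeroP l) H c; have [h1 [h2 hP]] := H c \0.
exists h1 => m; have [e1 _] := hP m; have [_ e2] := hP (y m).
move: e1 e2; rewrite operator_repF operator_repG => <- /eqP.
by rewrite subr_eq0 => /eqP ->.
Qed.
End KrepOf.

Lemma operator_rep_invertible l W (y : {linear W -> W}) :
  invertible_on [set l] (operator_rep l y).
Proof. by apply/invertible_on1; exists idfun => v; rewrite operator_repG. Qed.

(** For [V] with [G] bijective, [Hom] and [Ext^1] from [M] to [V] are governed by
    [h - y h z = c] with [y = F G^-1] on [V2], which is a geometric series. *)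
Lemma comodule_point l M (z : {linear kv1 M -> kv1 M}) :
  bijective (kF l M) -> (forall m, kF l M (z m) = kG l M m) ->
  locally_nilpotent z -> comodule [set l] M.
Proof.
move=> /bijective_linear_inv[fi [fK fiK]] zF zn V /invertible_on1.
move=> /bijective_linear_inv[gi [gK giK]].
pose y : {linear kv2 V -> kv2 V} := kF l V \o gi.
split.
  apply/Hom_zeroP => h.
  have h20 n : kh2 h n = 0.
    rewrite -[n]fiK; apply: (geometric_unique (y := y) (h := kh2 h \o kF l M) zn).
    by move=> u; rewrite /y /= zF -khG gK khF.
  by split=> // m; apply: (can_inj gK); rewrite khG h20 linear0.
apply/(Ext1_zeroP l) => a b.
have [h' h'P] := geometric_exists y ((kF l V \o gi \o b) \- a) zn.
exists (gi \o (b \+ (h' \o fi \o kG l M))), (h' \o fi) => m /=.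
rewrite giK fK addrK; split=> //.
rewrite -zF fK !linearD /= -[RHS](subKr (kF l V (gi (b m)))).
by rewrite -[kF l V _ - a m](h'P m) opprB addrA.
Qed.

(** The converse of [comodule_point], by testing against the polynomials in one
    variable with coefficients in [M1]: the coefficients of the solution [psi] of
    [psi F - t psi G = (m |-> m t^0)] are [F^-1], [F^-1 G F^-1] and so on, and
    [psi n] has finitely many of them. *)
Lemma comodule_pointP l M : comodule [set l] M ->
  bijective (kF l M) /\ exists z : {linear kv1 M -> kv1 M},
    (forall m, kF l M (z m) = kG l M m) /\ locally_nilpotent z.
Proof.
move=> H.
have [_ E1] := H _ (operator_rep_invertible l (@shift_up k (kv1 M))).
have [psi psiP] := Ext1_zero_operator E1 (fmonom 0).
have h0F m : fcoef 0 (psi (kF l M m)) = m.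
  have := congr1 (fcoef 0) (psiP m).
  by rewrite linearB /= fcoef0_shift_up subr0 fcoef_fmonom.
have hSF j m : fcoef j.+1 (psi (kF l M m)) = fcoef j (psi (kG l M m)).
  have := congr1 (fcoef j.+1) (psiP m).
  by rewrite linearB /= fcoefS_shift_up fcoef_fmonom => /eqP; rewrite subr_eq0 => /eqP.
have Fh0 n : kF l M (fcoef 0 (psi n)) = n.
  have [H2 _] := H _ (operator_rep_invertible l (@shift_up k (kv2 M))).
  pose chi : {linear kv2 M -> fseq (kv2 M)} := (fseq_map (kF l M) \o psi) \-
     (shift_up \o fseq_map (kG l M) \o psi) \- fmonom 0.
  suff chi0 : chi n = 0.
    have := congr1 (fcoef 0) chi0; rewrite /chi !linearB /= fcoef0_shift_up.
    by rewrite fcoef_map fcoef_fmonom subr0 linear0 => /eqP; rewrite subr_eq0 => /eqP.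
  apply: (Hom_zero_operator H2) => m.
  have psiE : psi (kF l M m) = shift_up (psi (kG l M m)) + fmonom 0 m.
    by rewrite -psiP addrC subrK.
  rewrite /chi /= psiE !linearB /= ![fseq_map _ (_ + _)]linearD /= !fseq_map_shift_up.
  rewrite !fseq_map_fmonom [shift_up (_ + _)]linearD /= addrAC addrK.
  by rewrite opprD addrA.
have Fb : bijective (kF l M) by exists (fcoef 0 \o psi).
split=> //; exists (fcoef 0 \o psi \o kG l M); split=> [m|m]; first exact: Fh0.
have [n nP] := fcoef_bound (psi (kF l M m)).
exists n; rewrite -(nP n) //.
elim: n {nP} m => [|n IH] m; first by rewrite h0F.
by rewrite hSF iterSr IH /= Fh0.
Qed.

End Points.

Section Contra.
Variable k : fieldType.
Implicit Types (l : P1 k) (M V C : krep k) (U W : lmodType k).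

Definition scalars : lmodType k := k^o.
Definition unit_scalar : scalars := (1 : k).

(** In terms of [z = F^-1 G] the system reads [h_n - z h_(n+1) = F^-1 c_n], so that
    [h_n] stands for the infinite sum of the [z^j F^-1 c_(n+j)]. *)
Definition uniquely_summable l C :=
  (forall c : nat -> kv2 C, exists h : nat -> kv1 C,
     forall n, kF l C (h n) - kG l C (h n.+1) = c n) /\
  (forall h : nat -> kv1 C, (forall n, kF l C (h n) = kG l C (h n.+1)) ->
     forall n, h n = 0).

Lemma uniquely_summable_eq l C : uniquely_summable l C -> forall h h' : nat -> kv1 C,
  (forall n, kF l C (h n) - kG l C (h n.+1) = kF l C (h' n) - kG l C (h' n.+1)) ->
  forall n, h n = h' n.
Proof.
move=> [_ HU] h h' e n; apply/eqP; rewrite -subr_eq0; apply/eqP.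
apply: (HU (fun n => h n - h' n)) => {}n; rewrite !linearB /=.
by apply/eqP; rewrite -subr_eq0 opprD opprK addrACA e addrACA subrr addNr addr0.
Qed.

Definition scalar_line W (w : W) (t : scalars) : W := t *: w.
Fact scalar_line_linear W (w : W) : linear (scalar_line w).
Proof. by move=> a x y; rewrite /scalar_line scalerDl scalerA. Qed.
HB.instance Definition _ W (w : W) :=
  GRing.isLinear.Build k scalars W _ (scalar_line w) (scalar_line_linear w).

Definition seq_linear W (c : nat -> W) : {linear fseq scalars -> W} :=
  dsum_lift (V := fun _ => scalars) (fun n => scalar_line (c n)).

Lemma seq_linearE W (c : nat -> W) n : seq_linear c (fmonom n unit_scalar) = c n.
Proof.
rewrite [LHS](dsum_lift_in (V := fun _ => scalars) (fun n => scalar_line (c n))).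
exact: scale1r.
Qed.

Lemma fseq_scalar_ext W (f g : {linear fseq scalars -> W}) :
  (forall n, f (fmonom n unit_scalar) = g (fmonom n unit_scalar)) -> forall v, f v = g v.
Proof.
move=> e; apply: fseq_linear_ext => n x.
have -> : fmonom n x = (x : k) *: fmonom n unit_scalar.
  transitivity (fmonom n ((x : k) *: unit_scalar)); last exact: linearZZ.
    by congr fmonom; exact: esym (mulr1 x).
by rewrite (linearZZ f) (linearZZ g) e.
Qed.

(** A sequence is a linear map from the polynomials, and the index shift is
    multiplication by the variable.  So one direction is a test against the
    polynomials, and in the other one a solution is found at each vector [v] from the
    sequence of the [c (y^n v)]; it depends linearly on [v] by uniqueness. *)
Lemma contramodule_pointP l C :
  contramodule [set l] C <-> uniquely_summable l C.
Proof.
split=> [H|[HE HU]].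
  have [H0 E0] := H _ (operator_rep_invertible l (@shift_up k scalars)).
  split=> [c|h hP n].
    have [h hP] := Ext1_zero_from_operator E0 (seq_linear c).
    exists (fun n => h (fmonom n unit_scalar)) => n.
    by rewrite -(seq_linearE c) -hP /= shift_up_fmonom.
  rewrite -(seq_linearE h); apply: (Hom_zero_from_operator H0).
  apply: (fseq_scalar_ext (f := kF l C \o seq_linear h)
    (g := kG l C \o seq_linear h \o shift_up)) => i /=.
  by rewrite shift_up_fmonom !seq_linearE.
move=> V /invertible_on1/bijective_linear_inv[gi [gK giK]].
pose y : {linear kv1 V -> kv1 V} := gi \o kF l V.
have yF v : kG l V (y v) = kF l V v by rewrite /y /= giK.
split.
  apply/Hom_zeroP => h.
  have h10 v : kh1 h v = 0.
    apply: (HU (fun n => kh1 h (iter n y v)) _ 0%N) => n /=.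
    by rewrite khF khG /= giK.
  by split=> // w; rewrite -[w]giK -khG h10 linear0.
apply/(Ext1_zeroP l) => a b.
pose c : {linear kv1 V -> kv2 C} := a \- (b \o y).
have /choice[H HP] v := HE (fun n => c (iter n y v)).
have HL n : linear (fun v => H v n).
  move=> t u v /=; apply: (uniquely_summable_eq (conj HE HU) (h := H _)
    (h' := fun n => t *: H u n + H v n)) => {}n.
  rewrite HP [kF l C _]linearPZ [kG l C _]linearPZ opprD addrACA -scalerBr !HP.
  by rewrite iter_is_linear linearPZ.
have Hy v n : H (y v) n = H v n.+1.
  apply: (uniquely_summable_eq (conj HE HU) (h' := fun n => H v n.+1)) => {}n.
  by rewrite !HP iterSr.
exists (build_linear (HL 0%N)), ((kG l C \o build_linear (HL 0%N) \- b) \o gi) => v /=.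
rewrite gK subKr; split=> //.
by rewrite opprB addrCA addrC [H (gi _) _]Hy HP /c /= subrK.
Qed.

Lemma uniquely_summable_F l C : uniquely_summable l C -> bijective (kF l C).
Proof.
move=> [HE HU]; apply: inj_surj_bijective.
  apply: raddf_inj => m Fm.
  apply: (HU (fun n => if n is 0 then m else 0) _ 0%N).
  by case=> [|n]; rewrite ?Fm linear0 // linear0.
move=> c; have [h hP] := HE (fun n => if n is 0 then c else 0).
exists (h 0%N); rewrite -[RHS](hP 0%N) (HU (fun n => h n.+1)) ?linear0 ?addr0 //.
by move=> n; apply/eqP; rewrite -subr_eq0 hP.
Qed.

(** Up to a nonzero factor, the [G] at a point other than [l] is [F - b G] for some [b]. *)
Lemma pencil_invertible l V : (forall b, bijective (fun v => kF l V v - b *: kG l V v)) ->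
  forall m, m != l -> bijective (kG m V).
Proof.
move=> VB m; case: l VB => [c|] VB; case: m => [d|] //= ml;
  [|by apply: (eq_bij (VB 0)) => v; rewrite scale0r subr0|exact: VB].
have cd : c - d != 0 by rewrite subr_eq0; apply: contraNneq ml => ->.
have sb : bijective (fun v : kv2 V => (c - d) *: v).
  by exists (fun v => (c - d)^-1 *: v) => v; rewrite scalerA ?mulVf ?mulfV // scale1r.
apply: (eq_bij (bij_comp sb (VB (- (c - d)^-1)))) => v /=.
rewrite scaleNr opprK scalerDr scalerA mulfV // scale1r scalerBl.
by rewrite addrC addrA subrK.
Qed.

(** [F - b G = F (1 - b z)] with [z] locally nilpotent. *)
Lemma comodule_disjoint l m N : comodule [set l] N -> m != l -> bijective (kG m N).
Proof.
move=> /comodule_pointP[Fb [z [zF zn]]]; apply: pencil_invertible => b.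
apply: (eq_bij (bij_comp Fb (locally_nilpotent_one_sub_bijective b zn))) => v /=.
by rewrite linearBZ zF.
Qed.

(** The inverse of [F - b G] is the infinite sum of the [z^n b^n] after [F^-1]: the solution
    for the sequence [b^n c] is itself geometric of ratio [b], by uniqueness. *)
Lemma contramodule_disjoint l m C : contramodule [set l] C -> m != l -> bijective (kG m C).
Proof.
move=> /contramodule_pointP[HE HU]; apply: pencil_invertible => b.
pose f : {linear kv1 C -> kv2 C} := kF l C \- b \*: kG l C.
apply: (inj_surj_bijective (f := f)).
  apply: (raddf_inj (f := f)) => h fh.
  rewrite -[h]scale1r -[1](expr0 b).
  apply: (HU (fun n => b ^+ n *: h)) => n.
  apply/eqP; rewrite -subr_eq0 exprSr -scalerA (linearZZ (kF l C)).
  rewrite !(linearZZ (kG l C)) -scalerBr.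
  by rewrite -[_ - _]/(f h) fh scaler0.
move=> c; have [h hP] := HE (fun n => b ^+ n *: c); exists (h 0%N).
suff -> : f (h 0%N) = kF l C (h 0%N) - kG l C (h 1%N) by rewrite hP scale1r.
suff -> : h 1%N = b *: h 0%N by rewrite linearZZ.
apply: (uniquely_summable_eq (conj HE HU) (h := fun n => h n.+1)
  (h' := fun n => b *: h n)) => n.
by rewrite hP (linearZZ (kF l C)) (linearZZ (kG l C)) -scalerBr hP scalerA exprS.
Qed.

(** * Isomorphisms, sums and products *)

Lemma invertible_on_sub (X Y : set (P1 k)) V : X `<=` Y ->
  invertible_on Y V -> invertible_on X V.
Proof. by move=> XY /invertible_onP VY; apply/invertible_onP => l /XY; exact: VY. Qed.

Lemma comodule_sub (X Y : set (P1 k)) M : X `<=` Y -> comodule X M -> comodule Y M.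
Proof. by move=> XY MX V /(invertible_on_sub XY); exact: MX. Qed.

Lemma contramodule_sub (X Y : set (P1 k)) C : X `<=` Y ->
  contramodule X C -> contramodule Y C.
Proof. by move=> XY CX V /(invertible_on_sub XY); exact: CX. Qed.

Lemma comodule_iso X M M' (i : khom M M') : kiso i -> comodule X M -> comodule X M'.
Proof.
move=> [j [ji ij]] MX V /MX[/Hom_zeroP H0 /Ext1_zero_solvable HE]; split.
  apply/Hom_zeroP => h; have [e1 e2] := H0 (kcomp h i).
  split=> m.
    by have /= <- := congr1 (fun f : khom M' M' => kh1 h (kh1 f m)) ij; exact: e1.
  by have /= <- := congr1 (fun f : khom M' M' => kh2 h (kh2 f m)) ij; exact: e2.
apply: Ext_solvable_zero => a b.
have [h1 [h2 hP]] := HE (a \o kh1 i) (b \o kh1 i).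
exists (h1 \o kh1 j), (h2 \o kh2 j) => m /=; rewrite -!khf -!khg.
have [-> ->] := hP (kh1 j m).
by have /= -> := congr1 (fun f : khom M' M' => kh1 f m) ij.
Qed.

Lemma contramodule_iso X C C' (i : khom C C') : kiso i ->
  contramodule X C -> contramodule X C'.
Proof.
move=> [j [ji ij]] CX V /CX[/Hom_zeroP H0 /Ext1_zero_solvable HE].
have ij1 x : kh1 i (kh1 j x) = x by have /= := congr1 (fun f : khom C' C' => kh1 f x) ij.
have ij2 x : kh2 i (kh2 j x) = x by have /= := congr1 (fun f : khom C' C' => kh2 f x) ij.
split.
  apply/Hom_zeroP => h; have [e1 e2] := H0 (kcomp j h).
  split=> m.
    by rewrite -[LHS]ij1; have /= -> := e1 m; rewrite linear0.
  by rewrite -[LHS]ij2; have /= -> := e2 m; rewrite linear0.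
apply: Ext_solvable_zero => a b.
have [h1 [h2 hP]] := HE (kh2 j \o a) (kh2 j \o b).
exists (kh1 i \o h1), (kh2 i \o h2) => m /=; rewrite !khf !khg -!linearB.
by have [-> ->] := hP m; rewrite /= !ij2.
Qed.

Section Sums.
Variables (I : choiceType) (N : I -> krep k).

Fact ksum_in_f j v : kf (ksum N) (dsum_in j v) = dsum_in j (kf (N j) v).
Proof. exact: dsum_map_in. Qed.
Fact ksum_in_g j v : kg (ksum N) (dsum_in j v) = dsum_in j (kg (N j) v).
Proof. exact: dsum_map_in. Qed.
Definition ksum_in j : khom (N j) (ksum N) :=
  @Khom k (N j) (ksum N) (@dsum_in k I _ j) (@dsum_in k I _ j) (@ksum_in_f j) (@ksum_in_g j).
Definition ksum_proj j : khom (ksum N) (N j) :=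
  @Khom k (ksum N) (N j) (@dsum_coord k I _ j) (@dsum_coord k I _ j)
  (fun=> erefl) (fun=> erefl).

Lemma ksum_comodule X : (forall j, comodule X (N j)) -> comodule X (ksum N).
Proof.
move=> NX V VX; split.
  apply/Hom_zeroP => h.
  have H0 j := (Hom_zeroP _ _).1 (NX j V VX).1 (kcomp h (ksum_in j)).
  split; [apply: (dsum_linear_ext (f := kh1 h) (g := \0))|
          apply: (dsum_linear_ext (f := kh2 h) (g := \0))] => j x /=.
    exact: (H0 j).1.
  exact: (H0 j).2.
apply: Ext_solvable_zero => a b.
have /dependent_fun_choice[h1 /dependent_fun_choice[h2 hP]] j :=
  Ext1_zero_solvable (NX j V VX).2 (a \o kh1 (ksum_in j)) (b \o kh1 (ksum_in j)).
exists (dsum_lift h1), (dsum_lift h2) => m; split.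
  apply: (dsum_linear_ext (f := (kf V \o dsum_lift h1) \- (dsum_lift h2 \o kf (ksum N)))
    (g := a)) => j x /=.
  by rewrite ksum_in_f !dsum_lift_in (hP j x).1.
apply: (dsum_linear_ext (f := (kg V \o dsum_lift h1) \- (dsum_lift h2 \o kg (ksum N)))
  (g := b)) => j x /=.
by rewrite ksum_in_g !dsum_lift_in (hP j x).2.
Qed.
End Sums.

Section Products.
Variables (I : Type) (N : I -> krep k).

Definition dprod_coord (T : I -> lmodType k) i (x : dprod T) : T i := x i.
Fact dprod_coord_linear (T : I -> lmodType k) i : linear (@dprod_coord T i). Proof. by []. Qed.
HB.instance Definition _ (T : I -> lmodType k) i := GRing.isLinear.Build k (dprod T) (T i) _
  (@dprod_coord T i) (@dprod_coord_linear T i).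

Definition kprod_proj j : khom (kprod N) (N j) :=
  @Khom k (kprod N) (N j) (@dprod_coord (fun i => kv1 (N i)) j)
    (@dprod_coord (fun i => kv2 (N i)) j)
  (fun=> erefl) (fun=> erefl).

Definition dprod_pair (U : lmodType k) (T : I -> lmodType k)
  (u : forall i, {linear U -> T i}) (x : U) : dprod T := fun i => u i x.
Fact dprod_pair_linear U (T : I -> lmodType k) u : linear (@dprod_pair U T u).
Proof. by move=> a x y; apply: functional_extensionality_dep => i; exact: linearP. Qed.
HB.instance Definition _ U (T : I -> lmodType k) u := GRing.isLinear.Build k U (dprod T) _
  (@dprod_pair U T u) (@dprod_pair_linear U T u).

Lemma kprod_contramodule X : (forall j, contramodule X (N j)) -> contramodule X (kprod N).
Proof.
move=> NX V VX; split.
  apply/Hom_zeroP => h.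
  have H0 j := (Hom_zeroP _ _).1 (NX j V VX).1 (kcomp (kprod_proj j) h).
  by split=> v; apply: functional_extensionality_dep => j;
    [exact: (H0 j).1|exact: (H0 j).2].
apply: Ext_solvable_zero => a b.
have /dependent_fun_choice[h1 /dependent_fun_choice[h2 hP]] j :=
  Ext1_zero_solvable (NX j V VX).2 (kh2 (kprod_proj j) \o a) (kh2 (kprod_proj j) \o b).
exists (dprod_pair h1), (dprod_pair h2) => m.
by split; apply: functional_extensionality_dep => j; [exact: (hP j m).1|exact: (hP j m).2].
Qed.

Lemma kprod_invertible X : (forall j, invertible_on X (N j)) -> invertible_on X (kprod N).
Proof.
move=> NX; apply/invertible_onP => m Xm.
have /dependent_fun_choice[g gP] j : exists g, cancel (kG m (N j)) g /\ cancel g (kG m (N j)).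
  by have [g ? ?] := (invertible_onP _ _).1 (NX j) _ Xm; exists g.
have E (x : kv1 (kprod N)) j : kG m (kprod N) x j = kG m (N j) (x j) by case: (m).
exists (fun (x : kv2 (kprod N)) => (fun j => g j (x j)) : kv1 (kprod N)) => x;
  apply: functional_extensionality_dep => j; rewrite ?E; apply (gP j).
Qed.
End Products.
End Contra.

(** * Images of idempotents *)

Section FixedPoints.
Variables (k : fieldType) (W : lmodType k) (e : {linear W -> W}).

Definition fixpts : {pred W} := fun w => e w == w.
Fact fixpts_submod_closed : GRing.subsemimod_closed fixpts.
Proof.
split=> [|a x /eqP ex]; last by apply/eqP; rewrite linearZZ ex.
split; first by apply/eqP; rewrite linear0.
by move=> x y /eqP ex /eqP ey; apply/eqP; rewrite linearD ex ey.
Qed.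
HB.instance Definition _ := GRing.isSubmodClosed.Build k W fixpts fixpts_submod_closed.

Record fixspace := Fixspace { fix_val :> W; _ : fix_val \in fixpts }.
HB.instance Definition _ := [isSub for fix_val].
HB.instance Definition _ := [Choice of fixspace by <:].
HB.instance Definition _ := [SubChoice_isSubLmodule of fixspace by <:].

Lemma fix_valP (w : fixspace) : e (fix_val w) = fix_val w.
Proof. by case: w => w /= /eqP. Qed.
Fact fix_val_linear : linear fix_val. Proof. by []. Qed.
HB.instance Definition _ := GRing.isLinear.Build k fixspace W _ fix_val fix_val_linear.
End FixedPoints.

Section FixLift.
Variables (k : fieldType) (U W : lmodType k) (e : {linear W -> W}) (f : {linear U -> W}).
Hypothesis ef : forall u, e (f u) = f u.
Fact fix_lift_subproof u : f u \in fixpts e. Proof. by apply/eqP. Qed.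
Definition fix_lift (u : U) : fixspace e := Fixspace (fix_lift_subproof u).
Fact fix_lift_linear : linear fix_lift.
Proof. by move=> a x y; apply: val_inj; rewrite /= linearP. Qed.
Definition fix_liftl : {linear U -> fixspace e} := build_linear fix_lift_linear.
End FixLift.

Section FixRep.
Variables (k : fieldType) (M : krep k) (e : khom M M).
Implicit Type l : P1 k.

Fact fix_f_subproof (m : fixspace (kh1 e)) : kh2 e (kf M (fix_val m)) = kf M (fix_val m).
Proof. by rewrite -khf fix_valP. Qed.
Fact fix_g_subproof (m : fixspace (kh1 e)) : kh2 e (kg M (fix_val m)) = kg M (fix_val m).
Proof. by rewrite -khg fix_valP. Qed.

Definition kfix : krep k :=
  @Krep k (fixspace (kh1 e)) (fixspace (kh2 e))
    (fix_liftl (f := kf M \o @fix_val _ _ (kh1 e)) fix_f_subproof)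
    (fix_liftl (f := kg M \o @fix_val _ _ (kh1 e)) fix_g_subproof).

Definition kfix_in : khom kfix M :=
  @Khom k kfix M (@fix_val _ _ (kh1 e)) (@fix_val _ _ (kh2 e)) (fun=> erefl) (fun=> erefl).

Lemma kfix_in1_inj : injective (kh1 kfix_in). Proof. exact: val_inj. Qed.
Lemma kfix_in2_inj : injective (kh2 kfix_in). Proof. exact: val_inj. Qed.
Lemma kfix_in1P (v : kv1 kfix) : kh1 e (kh1 kfix_in v) = kh1 kfix_in v.
Proof. exact: fix_valP. Qed.
Lemma kfix_in2P (v : kv2 kfix) : kh2 e (kh2 kfix_in v) = kh2 kfix_in v.
Proof. exact: fix_valP. Qed.

Hypothesis e1 : forall m, kh1 e (kh1 e m) = kh1 e m.
Hypothesis e2 : forall m, kh2 e (kh2 e m) = kh2 e m.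

Fact kfix_proj_f m : kf kfix (fix_lift e1 m) = fix_lift e2 (kf M m).
Proof. by apply: val_inj; rewrite /= khf. Qed.
Fact kfix_proj_g m : kg kfix (fix_lift e1 m) = fix_lift e2 (kg M m).
Proof. by apply: val_inj; rewrite /= khg. Qed.
Definition kfix_proj : khom M kfix :=
  @Khom k M kfix (fix_liftl e1) (fix_liftl e2) kfix_proj_f kfix_proj_g.

Lemma kfix_inproj1 m : kh1 kfix_in (kh1 kfix_proj m) = kh1 e m. Proof. by []. Qed.
Lemma kfix_inproj2 m : kh2 kfix_in (kh2 kfix_proj m) = kh2 e m. Proof. by []. Qed.
Lemma kfix_projin2 v : kh2 kfix_proj (kh2 kfix_in v) = v.
Proof. by apply: kfix_in2_inj; rewrite kfix_inproj2 kfix_in2P. Qed.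
End FixRep.

(** In both halves of the theorem the idempotent at [l] arises from maps [th] and [th'],
    consecutive coefficients of a partial fraction expansion, by the relations below. *)
Section Theta.
Variables (k : fieldType) (M : krep k) (l : P1 k) (th th' : {linear kv2 M -> kv1 M}).
Hypothesis Gth : forall n, kG l M (th n) = kF l M (th' n).
Hypothesis thG : forall m, th (kG l M m) = th' (kF l M m).

Definition projector1 : {linear kv1 M -> kv1 M} := th \o kF l M.
Definition projector2 : {linear kv2 M -> kv2 M} := kF l M \o th.
Fact projector_F m : kF l M (projector1 m) = projector2 (kF l M m). Proof. by []. Qed.
Fact projector_G m : kG l M (projector1 m) = projector2 (kG l M m).
Proof. by rewrite /= Gth thG. Qed.
Definition projector : khom M M := khom_of projector_F projector_G.

Hypothesis thFth : forall n, th (kF l M (th n)) = th n.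
Lemma projector1_idem m : kh1 projector (kh1 projector m) = kh1 projector m.
Proof. by rewrite /= thFth. Qed.
Lemma projector2_idem m : kh2 projector (kh2 projector m) = kh2 projector m.
Proof. by rewrite /= thFth. Qed.

Let N := kfix projector.
Fact theta_fix_subproof (n : kv2 N) : kh1 projector (th (kh2 (kfix_in projector) n)) = th (kh2
    (kfix_in projector) n).
Proof. by rewrite /= thFth. Qed.
Definition theta_fix : {linear kv2 N -> kv1 N} :=
  fix_liftl (f := th \o kh2 (kfix_in projector)) theta_fix_subproof.

Lemma theta_fixE n : kh1 (kfix_in projector) (theta_fix n) = th (kh2 (kfix_in projector) n).
Proof. by []. Qed.

Lemma theta_fixK : cancel theta_fix (kF l N).
Proof.
move=> n; apply: (@kfix_in2_inj _ _ projector).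
by rewrite -khF theta_fixE -[RHS]kfix_in2P.
Qed.
Lemma theta_fixKF : cancel (kF l N) theta_fix.
Proof.
move=> n; apply: (@kfix_in1_inj _ _ projector).
by rewrite theta_fixE -khF -[RHS]kfix_in1P.
Qed.
Lemma kF_fix_bijective : bijective (kF l N).
Proof. by exists theta_fix; [exact: theta_fixKF|exact: theta_fixK]. Qed.
End Theta.

(** * The idempotents of a comodule *)

Section AMap.
Variable k : fieldType.
Implicit Types U W : lmodType k.
Definition pfrac_map U W (f : {linear U -> W}) (x : pfrac U) : pfrac W :=
  dsum_map (fun _ => fseq_map f) x.
HB.instance Definition _ U W f := GRing.Linear.copy (@pfrac_map U W f) (dsum_map _).
Arguments pfrac_map : simpl never.
Lemma pf_part_map U W (f : {linear U -> W}) l x : pf_part l (pfrac_map f x) = fseq_map f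
    (pf_part l x).
Proof. by []. Qed.
Lemma pf_in_map U W (f : {linear U -> W}) l v : pfrac_map f (pf_in l v) = pf_in l (fseq_map f v).
Proof. exact: (@dsum_map_in k (option k) (fun _ => fseq U) (fun _ => fseq W)). Qed.
Lemma pf_const_map U W (f : {linear U -> W}) w : pfrac_map f (pf_const w) = pf_const (f w).
Proof. by rewrite /pf_const pf_in_map fseq_map_fmonom. Qed.
Lemma fseq_map_shift_down U W (f : {linear U -> W}) v :
  fseq_map f (shift_down v) = shift_down (fseq_map f v).
Proof. by apply: fseq_ext => j; rewrite fcoef_map !fcoef_shift_down fcoef_map. Qed.
Lemma pf_mulx_map U W (f : {linear U -> W}) x : pfrac_map f (pf_mulx x) = pf_mulx (pfrac_map f x).
Proof.
apply: (pfrac_linear_ext (f := pfrac_map f \o pf_mulx) (g := pf_mulx \o pfrac_map f)) => -[c|]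
    v /=.
  rewrite pf_mulx_in_fin linearD /= pf_const_map !pf_in_map pf_mulx_in_fin.
  by rewrite linearD /= (linearZZ (fseq_map f)) fseq_map_shift_down.
by rewrite pf_mulx_in_inf !pf_in_map pf_mulx_in_inf fseq_map_shift_up.
Qed.
Lemma pf_residue_map U W (f : {linear U -> W}) x : pf_residue (pfrac_map f x) = f (pf_residue x).
Proof.
apply: (pfrac_linear_ext (f := pf_residue \o pfrac_map f) (g := f \o pf_residue)) => l v /=.
by rewrite pf_in_map /pf_residue !pf_lift_in; case: l => [c|] /=; rewrite ?linear0.
Qed.
End AMap.

Lemma pfrac_rep_invertible (k : fieldType) (W : lmodType k) :
  invertible_on setT (operator_rep None (@pf_mulx k W)).
Proof. by split=> [c _|_]; [exact: pf_mulx_sub_bijective|exists idfun]. Qed.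

Section ComoduleProjectors.
Variables (k : fieldType) (M : krep k).
Hypothesis MT : comodule setT M.
Implicit Type l : P1 k.

(** Infinity is the point used for the test module, whence the roles of [f] and [g]. *)
Lemma pfrac_unique W (h : {linear kv2 M -> pfrac W}) :
  (forall m, h (kg M m) = pf_mulx (h (kf M m))) -> forall n, h n = 0.
Proof. exact: Hom_zero_operator (MT (@pfrac_rep_invertible k W)).1 h. Qed.

(** The solution of [psi g - x psi f = (m |-> m * 1)] with values in [M1 * A]. *)
Definition fraction : {linear kv2 M -> pfrac (kv1 M)} :=
  sval (cid (Ext1_zero_operator (MT (@pfrac_rep_invertible k (kv1 M))).2 pf_const)).

Lemma fraction_g m : fraction (kg M m) = pf_mulx (fraction (kf M m)) + pf_const m.
Proof.
have /(_ m) <- := svalP (cid (Ext1_zero_operator (MT (@pfrac_rep_invertible k (kv1 M))).2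
    pf_const)).
by rewrite addrC subrK.
Qed.

(** The same equation on the other side, in [M2 * A]: both sides differ by a solution of the
    homogeneous equation. *)
Lemma fraction_unit n :
  pfrac_map (kg M) (fraction n) = pf_mulx (pfrac_map (kf M) (fraction n)) + pf_const n.
Proof.
pose h : {linear kv2 M -> pfrac (kv2 M)} := (pfrac_map (kg M) \o fraction) \-
  (pf_mulx \o (pfrac_map (kf M) \o fraction)) \- pf_const.
suff : h n = 0.
  by rewrite /h /= => /eqP; rewrite subr_eq0 subr_eq addrC => /eqP.
apply: pfrac_unique => m; rewrite /h /= fraction_g.
rewrite ![pfrac_map _ (_ + _)]linearD /= !pf_const_map !pf_mulx_map.
rewrite [pf_mulx (_ + _)]linearD /= addrAC addrK [RHS]linearB /=.
by rewrite [pf_mulx (_ - _)]linearB opprD addrA.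
Qed.

(** At infinity this is the polynomial part. *)
Definition polar_part l n : fseq (kv1 M) := pf_part l (fraction n).

Lemma part_fraction_g l m : pf_part l (fraction (kg M m)) =
  pf_part l (pf_mulx (fraction (kf M m))) + pf_part l (pf_const m).
Proof. by rewrite fraction_g [LHS]linearD. Qed.

Lemma polar_part_G l m : polar_part l (kG l M m) = shift_down (polar_part l (kF l M m)).
Proof.
rewrite /polar_part; case: l => [c|] /=.
  rewrite (linearBZ fraction) (linearBZ (pf_part (Some c))) /= part_fraction_g pf_part_mulx_fin.
  by rewrite pf_part_in /= addr0 addrAC subrr add0r.
rewrite part_fraction_g pf_part_mulx_inf pf_part_in /=.
rewrite -addrA -[fmonom 0 _ + _]linearD [RHS]linearD /= shift_upK.
by rewrite shift_down_fmonom0 addr0.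
Qed.

Lemma G_polar_part l n :
  fseq_map (kG l M) (polar_part l n) = shift_down (fseq_map (kF l M) (polar_part l n)).
Proof.
have : pf_part l (pfrac_map (kg M) (fraction n)) =
    pf_part l (pf_mulx (pfrac_map (kf M) (fraction n))) + pf_part l (pf_const n).
  by rewrite fraction_unit [LHS]linearD.
rewrite /polar_part pf_part_map; case: l => [c|] /=.
  rewrite pf_part_mulx_fin pf_part_in /= addr0 pf_part_map => e.
  apply: fseq_ext => j; rewrite fcoef_map /= -(fcoef_map (kg M)) e [fcoef j (_ + _)]linearD /=.
  by rewrite (linearZZ (fcoef j)) /= -(fcoef_map (kf M)) addrAC subrr add0r.
rewrite pf_part_mulx_inf pf_part_in /= pf_part_map => ->.
rewrite -addrA -[fmonom 0 _ + _]linearD [RHS]linearD /= shift_upK.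
by rewrite shift_down_fmonom0 addr0.
Qed.

(** Comparing coefficients of 1 in the equation for [psi], the part at infinity and the
    finite parts occur with opposite signs, as [g - x f] has [g] as its constant term at
    infinity, and [- f] as the multiple of 1 split off by a pole. *)
Definition theta_sign l : k := if l is Some _ then -1 else 1.
Definition comod_theta l j (n : kv2 M) : kv1 M := theta_sign l *: fcoef j (polar_part l n).
Fact comod_theta_linear l j : linear (comod_theta l j).
Proof. exact: (linearP (theta_sign l \*: (fcoef j \o (pf_part l \o fraction)))). Qed.
HB.instance Definition _ l j :=
  GRing.isLinear.Build k (kv2 M) (kv1 M) _ (comod_theta l j) (comod_theta_linear l j).
Arguments comod_theta : simpl never.

Lemma comod_theta_G l j m : comod_theta l j (kG l M m) = comod_theta l j.+1 (kF l M m).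
Proof. by rewrite /comod_theta polar_part_G fcoef_shift_down. Qed.
Lemma G_comod_theta l j n : kG l M (comod_theta l j n) = kF l M (comod_theta l j.+1 n).
Proof.
rewrite /comod_theta (linearZZ (kG l M)) (linearZZ (kF l M)).
by rewrite -(fcoef_map (kG l M)) -(fcoef_map (kF l M)) G_polar_part fcoef_shift_down.
Qed.

Definition comod_component l : khom M M := projector (G_comod_theta l 0) (comod_theta_G l 0).

(** Passing to the part at [l] commutes with multiplication by [x] up to a constant, and
    this constant is the value of the idempotent at [l]. *)
Lemma pf_in_polar_part_g l m : pf_in l (polar_part l (kg M m)) =
  pf_mulx (pf_in l (polar_part l (kf M m))) + pf_const (kh1 (comod_component l) m).
Proof.
rewrite -[kh1 _ m]/(comod_theta l 0 (kF l M m)) /comod_theta; case: l => [c|].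
  rewrite [theta_sign _]/= scaleN1r linearN pf_mulx_in_fin addrK.
  by rewrite /polar_part part_fraction_g pf_part_mulx_fin pf_part_in addr0.
rewrite [theta_sign _]/= scale1r pf_mulx_in_inf -[kf M m]/(kG None M m) polar_part_G.
by rewrite {1}[polar_part None (kg M m)]shift_decomp [LHS]linearD.
Qed.

(** Both [psi p] and the part of [psi] at [m], where [p] is the idempotent at [m], solve
    the same equation, so they agree. *)
Lemma polar_part_component l m n :
  polar_part l (kh2 (comod_component m) n) = if l == m then polar_part m n else 0.
Proof.
suff e : fraction (kh2 (comod_component m) n) = pf_in m (pf_part m (fraction n)).
  by rewrite /polar_part e pf_part_in.
pose h : {linear kv2 M -> pfrac (kv1 M)} := (fraction \o kh2 (comod_component m)) \-
  (pf_in m \o pf_part m \o fraction).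
suff : h n = 0 by rewrite /h /= => /eqP; rewrite subr_eq0 => /eqP.
apply: pfrac_unique => {}n; rewrite /h.
rewrite -[LHS]/(fraction (kh2 (comod_component m) (kg M n)) - pf_in m (polar_part m (kg M n))).
rewrite -[h (kf M n)]/(fraction (kh2 (comod_component m) (kf M n)) - pf_in m (polar_part m (kf
    M n))).
rewrite -khf -khg fraction_g pf_in_polar_part_g [RHS]linearB /=.
by rewrite opprD addrACA subrr addr0.
Qed.

Lemma comod_theta_component l m j n :
  comod_theta l j (kh2 (comod_component m) n) = if l == m then comod_theta l j n else 0.
Proof.
rewrite /comod_theta polar_part_component; case: eqP => [->//|_].
by rewrite [fcoef j 0]linear0 scaler0.
Qed.

Lemma comod_thetaFtheta l n : comod_theta l 0 (kF l M (comod_theta l 0 n)) = comod_theta l 0 n.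
Proof. by rewrite [LHS]comod_theta_component eqxx. Qed.

Lemma comod_component2_eq l m n :
  kh2 (comod_component l) (kh2 (comod_component m) n) = if l == m then kh2 (comod_component m)
      n else 0.
Proof.
rewrite -[LHS]/(kF l M (comod_theta l 0 (kh2 (comod_component m) n))) comod_theta_component.
by case: eqP => [->//|_]; rewrite linear0.
Qed.

Lemma comod_component1_eq l m n :
  kh1 (comod_component l) (kh1 (comod_component m) n) = if l == m then kh1 (comod_component m)
      n else 0.
Proof.
rewrite -[LHS]/(comod_theta l 0 (kF l M (kh1 (comod_component m) n))) khF comod_theta_component.
by case: eqP => [->//|_].
Qed.

(** On the image, the [j]-th power of [z = theta G] is the [j]-th coefficient of the
    expansion at [l], composed with [F]; at a given vector it vanishes for large [j]. *)
Lemma comod_component_comodule l : comodule [set l] (kfix (comod_component l)).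
Proof.
have Fb := kF_fix_bijective (G_comod_theta l 0) (comod_theta_G l 0) (comod_thetaFtheta l).
pose i := kfix_in (comod_component l).
pose th := theta_fix (G_comod_theta l 0) (comod_theta_G l 0) (comod_thetaFtheta l).
apply: (comodule_point (z := th \o kG l (kfix (comod_component l))) Fb) => [m|m].
  exact: theta_fixK.
have [N NP] := fcoef_bound (polar_part l (kF l M (kh1 i m))).
exists N; apply: (@kfix_in1_inj _ _ (comod_component l)).
have -> : kh1 i (iter N (th \o kG l (kfix (comod_component l))) m) =
    comod_theta l N (kF l M (kh1 i m)).
  elim: N {NP} m => [|N IH] m; first by rewrite -[LHS]kfix_in1P.
  have e : kh1 i ((th \o kG l (kfix (comod_component l))) m) = comod_theta l 0 (kG l M (kh1 i m)).
    by rewrite [LHS]theta_fixE khG.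
  rewrite iterSr IH e -[kF l M _]/(kh2 (comod_component l) (kG l M (kh1 i m))).
  by rewrite comod_theta_component eqxx comod_theta_G.
by rewrite /comod_theta NP // scaler0 linear0.
Qed.

Lemma const_coef_fraction_g m :
  pf_const_coef (fraction (kg M m)) = pf_residue (fraction (kf M m)) + m.
Proof.
rewrite pf_const_coefE part_fraction_g pf_part_mulx_inf pf_part_in.
by rewrite !(linearD (fcoef 0)) /= fcoef0_shift_up !fcoef_fmonom add0r.
Qed.

Lemma g_const_coef_fraction n :
  kg M (pf_const_coef (fraction n)) = kf M (pf_residue (fraction n)) + n.
Proof.
rewrite pf_const_coefE -(fcoef_map (kg M)) -pf_part_map fraction_unit.
rewrite (linearD (pf_part None)) /= pf_part_mulx_inf pf_part_in.
by rewrite !(linearD (fcoef 0)) /= fcoef0_shift_up !fcoef_fmonom add0r pf_residue_map.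
Qed.

(** The coefficient of 1 in [psi (g m) = x psi (f m) + m * 1]. *)
Lemma comod_component1_sum m : exists r : seq (P1 k), m = \sum_(l <- r) kh1 (comod_component l) m.
Proof.
have [r1 _ r1P] := dsum_supp (fraction (kf M m)).
have [r2 _ r2P] := dsum_supp (fraction (kg M m)).
have ru := undup_uniq (r1 ++ r2); set r := undup _ in ru.
have rP (l : option k) : l \notin r -> pf_part l (fraction (kf M m)) = 0 /\
    pf_part l (fraction (kg M m)) = 0.
  by rewrite mem_undup mem_cat negb_or => /andP[/r1P ? /r2P ?].
exists r; apply: (addrI (pf_residue (fraction (kf M m)))).
rewrite -const_coef_fraction_g /pf_const_coef /pf_residue.
rewrite !(pf_liftE _ ru) => [|l /rP[]//|l /rP[]//].
rewrite -big_split; apply: eq_bigr => l _ /=.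
rewrite -[kF l M _]/(kF l M m) /comod_theta /polar_part.
by case: l => [c|] /=; rewrite ?scaleN1r ?scale1r ?add0r ?subrr.
Qed.

(** The coefficient of 1 in the equation [fraction_unit]. *)
Lemma comod_component2_sum n : exists r : seq (P1 k), n = \sum_(l <- r) kh2 (comod_component l) n.
Proof.
have [r ru rP] := dsum_supp (fraction n).
exists r; apply: (addrI (kf M (pf_residue (fraction n)))).
rewrite -g_const_coef_fraction /pf_const_coef /pf_residue.
rewrite !(pf_liftE _ ru rP) !linear_sum -big_split; apply: eq_bigr => l _ /=.
rewrite /comod_theta /polar_part.
by case: l => [c|] /=; rewrite ?scaleN1r ?scale1r ?add0r ?linearN ?linear0 ?subrr ?add0r.
Qed.

End ComoduleProjectors.

(** * The idempotents of a contramodule *)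

Section ContramoduleProjectors.
Variables (k : fieldType) (C : krep k).
Hypothesis CT : contramodule setT C.
Implicit Types (l : P1 k) (W : lmodType k).

Notation P := (pfrac (scalars k)).
Implicit Types (c : {linear P -> kv2 C}) (h : {linear P -> kv1 C}).

Definition pf_one : P := pf_const (unit_scalar k).

Lemma pf_constE (s : scalars k) : pf_const s = (s : k) *: pf_one.
Proof.
rewrite /pf_one -(linearZZ (@pf_const k (scalars k))); congr pf_const.
exact: esym (mulr1 (s : k)).
Qed.

Lemma pfrac_scalar_ext W (f g : {linear P -> W}) :
  (forall l j, f (pf_in l (fmonom j (unit_scalar k))) = g (pf_in l (fmonom j (unit_scalar k)))) ->
  forall v, f v = g v.
Proof.
move=> e; apply: pfrac_linear_ext => l.
exact: (fseq_scalar_ext (f := f \o pf_in l) (g := g \o pf_in l) (e l)).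
Qed.

Definition solves c h := forall v, kg C (h v) - kf C (h (pf_mulx v)) = c v.

Definition solution c : {linear P -> kv1 C} :=
  sval (cid (Ext1_zero_from_operator (CT (@pfrac_rep_invertible k (scalars k))).2 c)).
Lemma solutionP c : solves c (solution c).
Proof. exact: svalP (cid _). Qed.

Lemma solution_unique c h : solves c h -> forall v, solution c v = h v.
Proof.
move=> hP v; apply/eqP; rewrite -subr_eq0; apply/eqP.
apply: (Hom_zero_from_operator (CT (@pfrac_rep_invertible k (scalars k))).1
  (h := solution c \- h)) => {}v /=.
rewrite (linearB (kg C)) (linearB (kf C)) /=; apply/eqP.
by rewrite -subr_eq0 opprD addrACA -opprD (solutionP c v) (hP v) subrr.
Qed.

(** The value at 1 of the solution.  As a function of [c] it is what the comodule solution
    [psi] is dual to. *)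
Definition integral c : kv1 C := solution c pf_one.

Lemma integral_solves c h : solves c h -> integral c = h pf_one.
Proof. by move=> /solution_unique; apply. Qed.

Lemma integral_ext c c' : (forall v, c v = c' v) -> integral c = integral c'.
Proof. by move=> e; apply: integral_solves => v; rewrite e; apply: solutionP. Qed.

Lemma integral_lin a c c' : integral ((a \*: c) \+ c') = a *: integral c + integral c'.
Proof.
apply: (integral_solves (h := (a \*: solution c) \+ solution c')) => v /=.
rewrite -(solutionP c v) -(solutionP c' v) (linearPZ (kg C)) (linearPZ (kf C)).
by rewrite scalerBr opprD addrACA.
Qed.

Lemma integral0 : integral \0 = 0.
Proof.
by apply: (integral_solves (h := \0)) => v /=; rewrite (linear0 (kg C)) (linear0 (kf C)) subrr.
Qed.

Lemma integralZ a c : integral (a \*: c) = a *: integral c.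
Proof.
rewrite -[RHS]addr0 -integral0 -integral_lin.
by apply: integral_ext => v /=; rewrite addr0.
Qed.

Lemma integralD c c' : integral (c \+ c') = integral c + integral c'.
Proof.
rewrite -[X in X + _]scale1r -integral_lin.
by apply: integral_ext => v /=; rewrite scale1r.
Qed.

Lemma integralB c c' : integral (c \- c') = integral c - integral c'.
Proof.
rewrite -[X in _ - X]scale1r -scaleNr addrC -integral_lin.
by apply: integral_ext => v /=; rewrite scaleN1r addrC.
Qed.

(** The solution for [c x] is that for [c] composed with [x], so this is the equation at 1. *)
Lemma integral_mulx c : kg C (integral c) - kf C (integral (c \o pf_mulx)) = c pf_one.
Proof.
rewrite -(solutionP c pf_one) /integral; congr (_ - kf C _).
by apply: (solution_unique (h := solution c \o pf_mulx)) => v; exact: solutionP.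
Qed.

Definition coord l j (v : P) : scalars k := fcoef j (pf_part l v).
HB.instance Definition _ l j := GRing.Linear.copy (coord l j) (fcoef j \o pf_part l).
Arguments coord : simpl never.

Definition contra_theta l j (d : kv2 C) : kv1 C :=
  theta_sign l *: integral (scalar_line d \o coord l j).
Fact contra_theta_linear l j : linear (contra_theta l j).
Proof.
move=> a x y; rewrite /contra_theta scalerA mulrC -scalerA -scalerDr -integral_lin.
congr (_ *: _); apply: integral_ext => v /=.
by rewrite /scalar_line scalerDr !scalerA mulrC.
Qed.
HB.instance Definition _ l j :=
  GRing.isLinear.Build k (kv2 C) (kv1 C) _ (contra_theta l j) (contra_theta_linear l j).
Arguments contra_theta : simpl never.

Lemma coord_mulx_fin a j v : coord (Some a) j (pf_mulx v) =
  a *: coord (Some a) j v + coord (Some a) j.+1 v.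
Proof.
rewrite /coord /= pf_part_mulx_fin (linearD (fcoef j)) /= fcoef_shift_down.
by rewrite (linearZZ (fcoef j)).
Qed.
Lemma coordS_mulx_inf j v : coord None j.+1 (pf_mulx v) = coord None j v.
Proof.
rewrite /coord /= pf_part_mulx_inf (linearD (fcoef j.+1)) /= fcoefS_shift_up.
by rewrite fcoef_fmonom addr0.
Qed.
Lemma coord0_mulx_inf v : coord None 0 (pf_mulx v) = pf_residue v.
Proof.
rewrite /coord /= pf_part_mulx_inf (linearD (fcoef 0)) /= fcoef0_shift_up.
by rewrite fcoef_fmonom add0r.
Qed.
Lemma coord_in l m j v : coord l j (pf_in m v) = if l == m then fcoef j v else 0.
Proof. by rewrite /coord /= pf_part_in; case: eqP => // _; rewrite linear0. Qed.
Lemma coord_one l j : coord l j pf_one = if (l == None) && (j == 0%N) then 1 else 0.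
Proof.
rewrite /pf_one /pf_const coord_in; case: eqP => //= _.
by rewrite fcoef_fmonom.
Qed.

Lemma G_contra_theta l j d : kG l C (contra_theta l j d) = kF l C (contra_theta l j.+1 d).
Proof.
rewrite /contra_theta (linearZZ (kG l C)) (linearZZ (kF l C)); congr (_ *: _).
case: l => [a|] /=.
  have := integral_mulx (scalar_line d \o coord (Some a) j).
  rewrite [RHS]/= coord_one /= /scalar_line scale0r => /eqP; rewrite subr_eq0 => /eqP ->.
  rewrite (integral_ext (c' := (a \*: (scalar_line d \o coord (Some a) j)) \+
    (scalar_line d \o coord (Some a) j.+1))) => [|v].
    by rewrite integral_lin linearD (linearZZ (kf C)) addrAC subrr add0r.
  by rewrite /= coord_mulx_fin /scalar_line scalerDl scalerA.
have := integral_mulx (scalar_line d \o coord None j.+1).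
rewrite [RHS]/= coord_one /= /scalar_line scale0r => /eqP; rewrite subr_eq0 => /eqP ->.
by congr (kf C _); apply: integral_ext => v; rewrite [RHS]/= coordS_mulx_inf.
Qed.

Lemma contra_theta_G l j m : contra_theta l j (kG l C m) = contra_theta l j.+1 (kF l C m).
Proof.
rewrite /contra_theta; congr (_ *: _); apply/eqP; rewrite -subr_eq0 -integralB; apply/eqP.
case: l => [a|].
  rewrite (integral_solves (h := scalar_line m \o coord (Some a) j)) => [|v] /=.
    by rewrite coord_one /scalar_line scale0r.
  rewrite coord_mulx_fin /scalar_line (linearZZ (kg C)) (linearZZ (kf C)).
  by rewrite scalerBr scalerDl opprD addrA scalerA mulrC -scalerA.
rewrite integralB; apply/eqP; rewrite subr_eq0 eq_sym -subr_eq0 -integralB.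
rewrite (integral_solves (h := scalar_line m \o coord None j.+1)) => [|v] /=.
  by rewrite coord_one /scalar_line scale0r.
by rewrite coordS_mulx_inf /scalar_line (linearZZ (kg C)) (linearZZ (kf C)).
Qed.

Definition contra_component l : khom C C := projector (G_contra_theta l 0) (contra_theta_G l 0).

Lemma contra_component1E l m :
  kh1 (contra_component l) m = theta_sign l *: integral (scalar_line (kF l C m) \o coord l 0).
Proof. by []. Qed.

(** If [h] solves the equation for [c], then [h] restricted to the part of [A] at [l] solves
    the one for [c] restricted to this part, up to an error: the multiples of 1 by
    which the projection fails to commute with [x].  The error integrates to the
    idempotent at [l] applied to [h 1]. *)
Lemma contra_component_integral l c :
  kh1 (contra_component l) (integral c) = integral (c \o (pf_in l \o pf_part l)).
Proof.
rewrite contra_component1E; set m := integral c.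
case: l => [a|].
  rewrite [theta_sign _]/= scaleN1r [kF _ _]/=.
  pose h : {linear P -> kv1 C} := solution c \o (pf_in (Some a) \o pf_part (Some a)).
  have comm v : pf_mulx (pf_in (Some a) (pf_part (Some a) v)) =
      pf_in (Some a) (pf_part (Some a) (pf_mulx v)) + (coord (Some a) 0 v : k) *: pf_one.
    by rewrite pf_mulx_in_fin pf_part_mulx_fin pf_constE.
  apply/esym; apply: (etrans (y := integral (c \o (pf_in (Some a) \o pf_part (Some a)) \+
      (scalar_line (kf C m) \o coord (Some a) 0)) - integral (scalar_line (kf C m) \o coord
          (Some a) 0))).
    by rewrite integralD addrK.
  rewrite (integral_solves (h := h)) => [|v].
    by rewrite /h /= /pf_one /pf_const pf_part_in linear0 linear0 add0r.
  rewrite /h /= -solutionP comm (linearD (solution c)) (linearZZ (solution c)) -[solution c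
      pf_one]/m.
  by rewrite (linearD (kf C)) (linearZZ (kf C)) opprD addrA subrK.
rewrite [theta_sign _]/= scale1r [kF _ _]/=.
pose h : {linear P -> kv1 C} := (solution c \o (pf_in None \o pf_part None)) \-
  (scalar_line m \o coord None 0).
apply/eqP; rewrite -subr_eq0 -opprB oppr_eq0 -integralB; apply/eqP.
rewrite (integral_solves (h := h)) => [|v].
  rewrite /h /= /pf_one coord_one /scalar_line scale1r /pf_const pf_part_in /=.
  by rewrite -[solution c _]/m subrr.
have comm : pf_in None (pf_part None (pf_mulx v)) =
    pf_mulx (pf_in None (pf_part None v)) + (pf_residue v : k) *: pf_one.
  by rewrite pf_mulx_in_inf pf_part_mulx_inf (linearD (pf_in None)) -pf_constE.
rewrite /h /= -solutionP comm (linearD (solution c)) (linearZZ (solution c)) -[solution c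
    pf_one]/m.
rewrite coord0_mulx_inf /scalar_line addrK (linearB (kg C)) (linearZZ (kg C)) /=.
by rewrite addrAC.
Qed.

Lemma contra_component_theta l m j d :
  kh1 (contra_component l) (contra_theta m j d) = if l == m then contra_theta m j d else 0.
Proof.
rewrite /contra_theta (linearZZ (kh1 (contra_component l))) contra_component_integral.
have [->|lm] := eqVneq l m.
  by congr (_ *: _); apply: integral_ext => v /=; rewrite coord_in eqxx.
rewrite (integral_ext (c' := \0)) ?integral0 ?scaler0 // => v /=.
by rewrite coord_in eq_sym (negPf lm) /scalar_line scale0r.
Qed.

Lemma contra_thetaFtheta l d : contra_theta l 0 (kF l C (contra_theta l 0 d)) = contra_theta l
    0 d.
Proof. by rewrite [LHS]contra_component_theta eqxx. Qed.

Lemma contra_component1_eq l m x :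
  kh1 (contra_component l) (kh1 (contra_component m) x) = if l == m then kh1 (contra_component
      m) x else 0.
Proof. exact: contra_component_theta. Qed.

Lemma contra_component2_eq l m d :
  kh2 (contra_component l) (kh2 (contra_component m) d) = if l == m then kh2 (contra_component
      m) d else 0.
Proof.
rewrite -[kh2 (contra_component m) d]/(kF m C (contra_theta m 0 d)) -khF contra_component_theta.
by case: eqP => // _; rewrite linear0.
Qed.

(** A chain with [F x_n = G x_(n+1)] provides a map on the part of [A] at [l] that is
    zero at 1 and solves the equation for the coefficient map of [F x_0], up to sign. *)
Lemma chain_zero l (x : nat -> kv1 C) :
  (forall n, kF l C (x n) = kG l C (x n.+1)) -> contra_theta l 0 (kF l C (x 0%N)) = 0.
Proof.
move=> xP; suff e : integral (scalar_line (kF l C (x 0%N)) \o coord l 0) = 0.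
  by rewrite /contra_theta e scaler0.
case: l xP => [a|] /= xP.
  pose h : {linear P -> kv1 C} := seq_linear (fun j => x j.+1) \o pf_part (Some a).
  have hin m t : h (pf_in m t) = if m == Some a then seq_linear (fun j => x j.+1) t else 0.
    by rewrite /h /= pf_part_in eq_sym; case: eqP => // _; rewrite linear0.
  clearbody h.
  rewrite (integral_solves (h := h)); first by rewrite /pf_one /pf_const hin.
  apply: (pfrac_scalar_ext (f := (kg C \o h) \- (kf C \o (h \o pf_mulx)))) => -[b|] j;
    rewrite /= coord_in eq_sym.
    rewrite pf_mulx_in_fin (linearD h) /= /pf_const !hin.
    case: (Some b =P Some a) => [[->]|_] /=; last first.
      by rewrite /scalar_line scale0r addr0 (linear0 (kg C)) (linear0 (kf C)) subr0.
    rewrite addr0 linearD (linearZZ (seq_linear _)) (linearD (kf C)) (linearZZ (kf C)) /=.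
    rewrite seq_linearE fcoef_fmonom opprD addrA -xP.
    case: j => [|j] /=.
      by rewrite shift_down_fmonom0 (linear0 (seq_linear _)) (linear0 (kf C)) subr0
          /scalar_line scale1r.
    by rewrite shift_down_fmonomS seq_linearE subrr /scalar_line scale0r.
  by rewrite pf_mulx_in_inf !hin /= /scalar_line scale0r (linear0 (kg C)) (linear0 (kf C)) subr0.
pose y j := if j is 0 then 0 else x j.
pose h : {linear P -> kv1 C} := seq_linear y \o pf_part None.
have hin m t : h (pf_in m t) = if m == None then seq_linear y t else 0.
  by rewrite /h /= pf_part_in eq_sym; case: eqP => // _; rewrite linear0.
clearbody h; apply: oppr_inj; rewrite oppr0 -scaleN1r -integralZ.
rewrite (integral_solves (h := h)); first by rewrite /pf_one /pf_const hin eqxx seq_linearE.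
apply: (pfrac_scalar_ext (f := (kg C \o h) \- (kf C \o (h \o pf_mulx)))) => -[b|] j;
  rewrite /= coord_in.
  rewrite pf_mulx_in_fin (linearD h) /= /pf_const !hin /= add0r fcoef_fmonom.
  rewrite /scalar_line scale0r scaler0 (linear0 (kg C)) sub0r.
  have -> : seq_linear y (fmonom 0 (if 0%N == j then unit_scalar k else 0)) = 0.
    by case: eqP => _; rewrite ?seq_linearE // !linear0.
  by rewrite linear0 oppr0.
rewrite pf_mulx_in_inf !hin /= shift_up_fmonom !seq_linearE fcoef_fmonom -xP.
case: j => [|j] /=; first by rewrite /scalar_line scale1r scaleN1r (linear0 (kg C)) sub0r xP.
by rewrite subrr /scalar_line scale0r scaler0.
Qed.

(** The solution for the map with coefficients [a_n], up to sign, on the part at [l],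
    evaluated along powers: at [x^n] for infinity, at [(x - c)^-n] for a finite point. *)
Lemma chain_exists l (a : nat -> kv2 C) :
  exists x : nat -> kv1 C, forall n, kF l C (x n) - kG l C (x n.+1) = a n.
Proof.
case: l => [b|].
  pose u : {linear P -> kv2 C} := (-1) \*: (seq_linear a \o pf_part (Some b)).
  pose B j : P := if j is j'.+1 then pf_in (Some b) (fmonom j' (unit_scalar k)) else pf_one.
  have mulB j : pf_mulx (B j.+1) = b *: B j.+1 + B j.
    rewrite /= pf_mulx_in_fin fcoef_fmonom (linearD (pf_in _)) (linearZZ (pf_in _)) -addrA.
    case: j => [|j] /=; first by rewrite shift_down_fmonom0 linear0 add0r.
    by rewrite shift_down_fmonomS (linear0 pf_const) addr0.
  have uB j : u (B j.+1) = - a j.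
    by rewrite /u /= pf_part_in eqxx seq_linearE scaleN1r.
  exists (fun j => solution u (B j)) => n; rewrite [kF _ _]/= -[kG _ _ _]/(_ - b *: _).
  apply: oppr_inj; rewrite -uB -(solutionP u) mulB (linearD (solution u)) (linearZZ (solution u)).
  by rewrite (linearD (kf C)) (linearZZ (kf C)) !opprB opprD addrA.
pose u : {linear P -> kv2 C} := seq_linear a \o pf_part None.
exists (fun j => solution u (pf_in None (fmonom j (unit_scalar k)))) => n /=.
rewrite -shift_up_fmonom -pf_mulx_in_inf (solutionP u) /u /= pf_part_in /=.
by rewrite seq_linearE.
Qed.

Lemma contra_component_contramodule l : contramodule [set l] (kfix (contra_component l)).
Proof.
have Fb := kF_fix_bijective (G_contra_theta l 0) (contra_theta_G l 0) (contra_thetaFtheta l).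
pose i := kfix_in (contra_component l).
pose p := kfix_proj (projector1_idem (G_contra_theta l 0) (contra_theta_G l 0)
    (contra_thetaFtheta l))
  (projector2_idem (G_contra_theta l 0) (contra_theta_G l 0) (contra_thetaFtheta l)).
apply/contramodule_pointP; split=> [c|h hP n].
  suff [H HP] : exists H : nat -> kv1 C, forall n,
      kF l C (H n) - kG l C (H n.+1) = kh2 i (c n).
    exists (fun n => kh1 p (H n)) => n.
    by rewrite khF khG -(linearB (kh2 p)) HP /p kfix_projin2.
  exact: chain_exists (fun n => kh2 i (c n)).
apply: (@kfix_in1_inj _ _ (contra_component l)); rewrite linear0 -kfix_in1P.
rewrite -[LHS]/(contra_theta l 0 (kF l C (kh1 i (h (0 + n)%N)))).
apply: (chain_zero (x := fun j => kh1 i (h (j + n)%N))) => j.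
by rewrite khF hP -khG.
Qed.

(** [m] is the integral of some [c] each of whose restrictions to a part of [A] integrates
    to zero.  Their solutions vanish at 1, and therefore glue to a solution for [c]
    that vanishes at 1. *)
Lemma contra_component1_injective m : (forall l, kh1 (contra_component l) m = 0) -> m = 0.
Proof.
move=> m0.
pose c : {linear P -> kv2 C} := (scalar_line (kg C m) \o coord None 0) \-
  (scalar_line (kf C m) \o (coord None 0 \o pf_mulx)).
have cm : integral c = m.
  rewrite (integral_solves (h := scalar_line m \o coord None 0)) => [|v] /=.
    by rewrite coord_one /scalar_line scale1r.
  by rewrite /scalar_line (linearZZ (kg C)) (linearZZ (kf C)).
pose h l := solution (c \o (pf_in l \o pf_part l)).
have h_one l : h l pf_one = 0 by rewrite -[LHS]contra_component_integral cm.
pose H : {linear P -> kv1 C} := pf_lift (fun l => h l \o pf_in l).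
have Hin l t : H (pf_in l t) = h l (pf_in l t) by rewrite /H /= pf_lift_in.
have H_one : H pf_one = 0 by rewrite /pf_one /pf_const Hin -[pf_in _ _]/pf_one h_one.
clearbody H.
rewrite -cm (integral_solves (h := H)) //.
apply: (pfrac_linear_ext (f := (kg C \o H) \- (kf C \o (H \o pf_mulx)))) => l t /=.
have -> : H (pf_mulx (pf_in l t)) = h l (pf_mulx (pf_in l t)).
  case: l => [b|]; last by rewrite pf_mulx_in_inf Hin.
  rewrite pf_mulx_in_fin (linearD H) (linearD (h _)) /= Hin pf_constE (linearZZ H) (linearZZ (h
      _)).
  by rewrite H_one h_one.
rewrite Hin (solutionP (c \o (pf_in l \o pf_part l))) /=.
by rewrite pf_part_in eqxx.
Qed.

(** Such a [d] is, up to sign, the image under [f] of an integral [m] to which the previous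
    lemma applies. *)
Lemma contra_component2_injective d : (forall l, kh2 (contra_component l) d = 0) -> d = 0.
Proof.
move=> d0.
pose m := integral (scalar_line d \o pf_residue).
have dE : d = - kf C m.
  have := integral_mulx (scalar_line d \o coord None 0).
  rewrite [RHS]/= coord_one [RHS]scale1r => e; rewrite -[LHS]e.
  have -> : kg C (integral (scalar_line d \o coord None 0)) = kh2 (contra_component None) d.
    by rewrite -[RHS]/(kg C (contra_theta None 0 d)) /contra_theta scale1r.
  rewrite d0 sub0r; congr (- kf C _); apply: integral_ext => v /=.
  by rewrite coord0_mulx_inf.
suff m0 : m = 0 by rewrite dE m0 linear0 oppr0.
apply: contra_component1_injective => -[b|].
  have e0 : kh2 (contra_component (Some b)) (kf C m) = 0.
    by apply: oppr_inj; rewrite oppr0 -linearN -dE d0.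
  have := contra_component1_eq (Some b) (Some b) m; rewrite eqxx => <-.
  rewrite -[LHS]/(contra_theta (Some b) 0 (kF (Some b) C (kh1 (contra_component (Some b)) m))).
  by rewrite khF [kF _ _ m]/= e0 linear0.
rewrite contra_component_integral -integral0; apply: integral_ext => v /=.
by rewrite /pf_residue pf_lift_in /= /scalar_line scale0r.
Qed.

(** Linear maps on the parts of [A] glue without any finiteness condition. *)
Lemma contra_component1_surjective (x : P1 k -> kv1 C) :
  (forall l, kh1 (contra_component l) (x l) = x l) ->
  exists m, forall l, kh1 (contra_component l) m = x l.
Proof.
move=> xP.
pose c : {linear P -> kv2 C} :=
  pf_lift (fun l => theta_sign l \*: (scalar_line (kF l C (x l)) \o fcoef 0)).
exists (integral c) => l; rewrite contra_component_integral -[RHS]xP contra_component1E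
    -integralZ.
by apply: integral_ext => v; rewrite /= /c /= pf_lift_in.
Qed.

(** [F] identifies the two components of the image at [l]; as [F] is [f] at all finite
    points and [g] at infinity, [f] and [g] reduce this to the case of [C1]. *)
Lemma contra_component2_surjective (x : P1 k -> kv2 C) :
  (forall l, kh2 (contra_component l) (x l) = x l) ->
  exists d, forall l, kh2 (contra_component l) d = x l.
Proof.
move=> xP.
pose y l := contra_theta l 0 (x l).
have yP l : kh1 (contra_component l) (y l) = y l by rewrite contra_component_theta eqxx.
have Fy l : kF l C (y l) = x l by exact: xP.
have [m mP] : exists m, forall l, kh1 (contra_component l) m = if l is Some _ then y l else 0.
  by apply: contra_component1_surjective => -[b|]; [exact: yP|rewrite linear0].
exists (kf C m + kg C (y None)) => l; rewrite linearD -khf -khg mP.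
rewrite -[y None]yP contra_component1_eq yP.
by case: l => [b|] /=; rewrite linear0 ?addr0 ?add0r; exact: Fy.
Qed.
End ContramoduleProjectors.

(** * Equivalences of categories *)

Local Notation hom := Defs.hom.

Section Categories.
Variables (C D : category) (F : functor C D).

Lemma equivalence_fully_faithful_ess_surj :
  (forall (a b : C) (g : hom (F a) (F b)), exists! f : hom a b, fmap F f = g) ->
  (forall d : D, exists a : C, exists i : hom (F a) d, is_iso i) ->
  is_equivalence F.
Proof.
move=> ff es.
have full (a b : C) (g : hom (F a) (F b)) : exists f, fmap F f = g.
  by have [f []] := ff a b g; exists f.
have faith (a b : C) (f f' : hom a b) : fmap F f = fmap F f' -> f = f'.
  by move=> e; have [f0 [_ u]] := ff a b (fmap F f'); rewrite -(u f e) -(u f' erefl).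
have /dependent_fun_choice[G0 /dependent_fun_choice[i /dependent_fun_choice[j ij]]] := es.
pose pre (a b : C) (g : hom (F a) (F b)) := sval (cid (full a b g)).
have preE (a b : C) (g : hom (F a) (F b)) : fmap F (pre a b g) = g by exact: (svalP (cid (full
    a b g))).
pose G1 (d d' : D) (g : hom d d') := pre (G0 d) (G0 d') (compm (j d') (compm g (i d))).
have G1id d : G1 d d (idm d) = idm (G0 d).
  by apply: faith; rewrite preE fmap1 comp1m (ij d).1.
have G1M (a b c : D) (g : hom b c) (f : hom a b) : G1 a c (compm g f) = compm (G1 b c g) (G1 a
    b f).
  apply: faith; rewrite fmapM !preE -!Defs.compA; congr (compm _ (compm _ _)).
  by rewrite !Defs.compA (ij b).2 comp1m.
exists (@Functor D C G0 G1 G1id G1M); split.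
  exists (fun a => pre (G0 (F a)) a (i (F a))); split=> [a|a b f].
    exists (pre a (G0 (F a)) (j (F a))).
    by split; apply: faith; rewrite fmapM !preE fmap1; [exact: (ij _).1|exact: (ij _).2].
  apply: faith; rewrite /= !fmapM !preE.
  by rewrite !Defs.compA (ij (F b)).2 comp1m.
exists i; split=> [d|a b f]; first by exists (j d); exact: ij.
by rewrite /= preE !Defs.compA (ij b).2 comp1m.
Qed.
End Categories.

(** * Morphisms between sums and between products *)

Section Diagonal.
Variable k : fieldType.

Lemma kcompA (U V W Z : krep k) (h : khom W Z) (g : khom V W) (f : khom U V) :
  kcomp h (kcomp g f) = kcomp (kcomp h g) f.
Proof. exact: (@Defs.compA (krep_cat k)). Qed.
Lemma kcomp1l (V W : krep k) (f : khom V W) : kcomp (kid W) f = f.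
Proof. exact: (@comp1m (krep_cat k)). Qed.
Lemma kcomp1r (V W : krep k) (f : khom V W) : kcomp f (kid V) = f.
Proof. exact: (@compm1 (krep_cat k)). Qed.

Lemma comodule_hom_zero (l m : P1 k) (N N' : krep k) : l != m ->
  comodule [set l] N -> comodule [set m] N' -> Hom_zero N N'.
Proof.
move=> lm Nl N'm; apply: (Nl _ _).1; apply/invertible_on1.
exact: comodule_disjoint N'm lm.
Qed.

Lemma contramodule_hom_zero (m : P1 k) (V C : krep k) : invertible_on [set m] V ->
  contramodule [set m] C -> Hom_zero V C.
Proof. by move=> Vm Cm; exact: (Cm _ Vm).1. Qed.

Section SumDiagonal.
Variables (X : set (P1 k)) (N N' : X -> krep k).
Hypothesis NP : forall l : X, comodule [set sval l] (N l).
Hypothesis N'P : forall l : X, comodule [set sval l] (N' l).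

(** There are no nonzero morphisms from an [{l}]-comodule to an [{m}]-comodule for
    [m] other than [l], since the latter is invertible at [l]. *)
Lemma ksum_hom_diagonal (g : khom (ksum N) (ksum N')) :
  exists! t : (forall l : X, khom (N l) (N' l)), ksum_hom t = g.
Proof.
pose t (l : X) := kcomp (ksum_proj N' l) (kcomp g (ksum_in N l)).
have off (l m : X) : l != m -> kcomp (ksum_proj N' m) (kcomp g (ksum_in N l)) = kzero _ _.
  by move=> lm; apply: (comodule_hom_zero (l := sval l) (m := sval m)).
exists t; split.
  apply: khom_ext.
    apply: (dsum_linear_ext (f := kh1 (ksum_hom t)) (g := kh1 g)) => l x.
    rewrite [LHS](dsum_map_in (fun l : X => kh1 (t l))); apply: dsum_ext => m.
    have [<-|lm] := eqVneq l m; first by rewrite dsum_in_id.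
    by rewrite dsum_in_out //; have := congr1 (fun h => kh1 h x) (off _ _ lm).
  apply: (dsum_linear_ext (f := kh2 (ksum_hom t)) (g := kh2 g)) => l x.
  rewrite [LHS](dsum_map_in (fun l : X => kh2 (t l))); apply: dsum_ext => m.
  have [<-|lm] := eqVneq l m; first by rewrite dsum_in_id.
  by rewrite dsum_in_out //; have := congr1 (fun h => kh2 h x) (off _ _ lm).
move=> t' e; rewrite /t -e; apply: functional_extensionality_dep => l.
apply: khom_ext => x /=.
  by rewrite [dsum_map _ _](dsum_map_in (fun l : X => kh1 (t' l))) dsum_in_id.
by rewrite [dsum_map _ _](dsum_map_in (fun l : X => kh2 (t' l))) dsum_in_id.
Qed.
End SumDiagonal.

Section ProductDiagonal.
Variables (X : set (P1 k)) (N N' : X -> krep k).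
Hypothesis NP : forall l : X, contramodule [set sval l] (N l).
Hypothesis N'P : forall l : X, contramodule [set sval l] (N' l).

Section Omit.
Variable m : X.
Let others := {l : X | l != m}.
Definition kprod_others : krep k := kprod (fun l : others => N (sval l)).

(** A product is not determined by morphisms out of its factors, so it is the whole
    product of the factors at the points other than [m] that must be seen to have no
    morphisms to an [{m}]-contramodule. *)
Lemma kprod_others_invertible : invertible_on [set sval m] kprod_others.
Proof.
apply: kprod_invertible => -[l /= lm]; apply/invertible_on1.
by apply: (contramodule_disjoint (@NP l)); apply: contraNneq lm => e; apply/eqP/val_inj/esym.
Qed.

Definition extend0 (V : X -> lmodType k) (x : dprod (fun l : others => V (sval l))) : dprod V :=
  fun l => if boolP (l != m) is AltTrue p then x (exist _ l p) else 0.
Fact extend0_linear V : linear (@extend0 V).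
Proof.
move=> a x y; apply: functional_extensionality_dep => l.
rewrite dprodD dprodZ /extend0; case: {-}_ / boolP => // _.
by rewrite scaler0 addr0.
Qed.
Lemma extend0_natural (V W : X -> lmodType k) (f : forall l, {linear V l -> W l}) x :
  dprod_map f (extend0 x) = extend0 (dprod_map (fun l : others => f (sval l)) x).
Proof.
apply: functional_extensionality_dep => l.
by rewrite /dprod_map /extend0; case: {-}_ / boolP => // _; rewrite linear0.
Qed.
Definition kprod_others_in : khom kprod_others (kprod N) :=
  @Khom k kprod_others (kprod N) (build_linear (@extend0_linear (fun l => kv1 (N l))))
    (build_linear (@extend0_linear (fun l => kv2 (N l))))
    (extend0_natural (fun l => kf (N l))) (extend0_natural (fun l => kg (N l))).

Lemma extend0_surj (V : X -> lmodType k) (x : dprod V) : x m = 0 ->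
  x = extend0 (fun l : others => x (sval l)).
Proof.
move=> xm; apply: functional_extensionality_dep => l.
by rewrite /extend0; case: {-}_ / boolP => // /negPn/eqP ->.
Qed.

Lemma kprod_hom_vanish (h : khom (kprod N) (N' m)) :
  (forall x, x m = 0 -> kh1 h x = 0) /\ (forall x, x m = 0 -> kh2 h x = 0).
Proof.
have /Hom_zeroP/(_ (kcomp h kprod_others_in))[h1 h2] :=
  contramodule_hom_zero kprod_others_invertible (@N'P m).
by split=> x /extend0_surj ->; [exact: h1|exact: h2].
Qed.
End Omit.

Definition dprod_in (V : X -> lmodType k) (l : X) (x : V l) : dprod V := dsum_val (dsum_in l x).

Fact dprod_in_f (l : X) v : kf (kprod N) (dprod_in v) = dprod_in (kf (N l) v).
Proof. exact: (congr1 (@dsum_val _ _ _) (ksum_in_f v)). Qed.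
Fact dprod_in_g (l : X) v : kg (kprod N) (dprod_in v) = dprod_in (kg (N l) v).
Proof. exact: (congr1 (@dsum_val _ _ _) (ksum_in_g v)). Qed.
Fact dprod_in_linear (V : X -> lmodType k) (l : X) : linear (@dprod_in V l).
Proof. by move=> a x y; rewrite /dprod_in linearP. Qed.
Definition kprod_in (l : X) : khom (N l) (kprod N) :=
  @Khom k (N l) (kprod N) (build_linear (@dprod_in_linear _ l)) (build_linear (@dprod_in_linear
      _ l))
    (@dprod_in_f l) (@dprod_in_g l).

Lemma kprod_hom_diagonal (g : khom (kprod N) (kprod N')) :
  exists! t : (forall l : X, khom (N l) (N' l)), kprod_hom t = g.
Proof.
pose t (l : X) := kcomp (kprod_proj N' l) (kcomp g (kprod_in l)).
exists t; split.
  apply: khom_ext => x; apply: functional_extensionality_dep => l; apply/esym/eqP;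
    rewrite -subr_eq0; apply/eqP.
    have [v1 _] := kprod_hom_vanish (kcomp (kprod_proj N' l) g).
    have := v1 (x - dprod_in (x l)); rewrite linearB; apply.
    by rewrite -[LHS]/(x l - dsum_coord l (dsum_in l (x l))) dsum_in_id subrr.
  have [_ v2] := kprod_hom_vanish (kcomp (kprod_proj N' l) g).
  have := v2 (x - dprod_in (x l)); rewrite linearB; apply.
  by rewrite -[LHS]/(x l - dsum_coord l (dsum_in l (x l))) dsum_in_id subrr.
move=> t' e; rewrite /t -e; apply: functional_extensionality_dep => l.
apply: khom_ext => x; rewrite -[LHS]/(_ (dsum_coord l (dsum_in l x))); by rewrite dsum_in_id.
Qed.
End ProductDiagonal.
End Diagonal.

(** * Decomposition over a set of points *)

Section Existence.
Variables (k : fieldType) (X : set (P1 k)).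

Section ComoduleExistence.
Variable M : krep k.
Hypothesis MX : comodule X M.

Let MT : comodule setT M := comodule_sub (@subsetT _ X) MX.
Let e (l : P1 k) := comod_component MT l.

(** For [l] outside [X] the image of the idempotent is invertible on [X], so that an
    [X]-comodule has no nonzero morphism to it. *)
Lemma comod_component_outside l : ~ X l -> e l = kzero M M.
Proof.
move=> Xl.
have Nl : invertible_on X (kfix (e l)).
  apply/invertible_onP => m Xm; apply: (comodule_disjoint (@comod_component_comodule _ _ MT l)).
  by apply/eqP => ml; apply: Xl; rewrite -ml.
have e1 m : kh1 (e l) (kh1 (e l) m) = kh1 (e l) m by rewrite [LHS]comod_component1_eq eqxx.
have e2 m : kh2 (e l) (kh2 (e l) m) = kh2 (e l) m by rewrite [LHS]comod_component2_eq eqxx.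
have p0 := (MX Nl).1 (kfix_proj e1 e2).
apply: khom_ext => m.
  by rewrite -[LHS](kfix_inproj1 e1 e2) p0 linear0.
by rewrite -[LHS](kfix_inproj2 e1 e2) p0 linear0.
Qed.

Let N (l : X) : krep k := kfix (e (sval l)).

Fact comodule_sum_f v :
  kf M (dsum_lift (fun l : X => kh1 (kfix_in (e (sval l)))) v) =
  dsum_lift (fun l : X => kh2 (kfix_in (e (sval l)))) (kf (ksum N) v).
Proof.
apply: (dsum_linear_ext (f := kf M \o dsum_lift _) (g := dsum_lift _ \o kf (ksum N))) => l x /=.
rewrite [dsum_map _ _](dsum_map_in (fun l : X => kf (N l))).
by rewrite !dsum_lift_in; exact: (khf (kfix_in (e (sval l)))). 
Qed.
Fact comodule_sum_g v :
  kg M (dsum_lift (fun l : X => kh1 (kfix_in (e (sval l)))) v) =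
  dsum_lift (fun l : X => kh2 (kfix_in (e (sval l)))) (kg (ksum N) v).
Proof.
apply: (dsum_linear_ext (f := kg M \o dsum_lift _) (g := dsum_lift _ \o kg (ksum N))) => l x /=.
rewrite [dsum_map _ _](dsum_map_in (fun l : X => kg (N l))).
by rewrite !dsum_lift_in; exact: (khg (kfix_in (e (sval l)))).
Qed.
Definition comodule_sum : khom (ksum N) M := @Khom k (ksum N) M
  (dsum_lift (fun l : X => kh1 (kfix_in (e (sval l)))))
  (dsum_lift (fun l : X => kh2 (kfix_in (e (sval l)))))
  comodule_sum_f comodule_sum_g.

Lemma lift_fixed_bijective (W : lmodType k) (a : P1 k -> {linear W -> W}) :
  (forall l m w, a l (a m w) = if l == m then a m w else 0) ->
  (forall w, exists r : seq (P1 k), w = \sum_(l <- r) a l w) ->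
  (forall l, ~ X l -> forall w, a l w = 0) ->
  bijective (dsum_lift (V := fun l : X => fixspace (a (sval l)))
    (fun l => @fix_val _ _ (a (sval l)))).
Proof.
move=> aa asum aX; set i := dsum_lift _.
apply: (inj_surj_bijective (f := i)).
  apply: raddf_inj => v iv.
  have ai (l : X) w : a (sval l) (i w) = fix_val (dsum_coord l w).
    apply: (dsum_linear_ext (f := a (sval l) \o i) (g := @fix_val _ _ _ \o dsum_coord l)).
    move=> m x /=; rewrite /i dsum_lift_in /= -[fix_val x]fix_valP aa.
    have [->|lm] := eqVneq l m; first by rewrite eqxx fix_valP dsum_in_id.
    rewrite dsum_in_out ?linear0 1?eq_sym //; case: eqP => // /val_inj e'.
    by rewrite e' eqxx in lm.
  apply: dsum_ext => l; apply: val_inj.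
  by rewrite -[LHS]ai (iv : i v = 0) !linear0.
move=> w; have [r ->] := asum w; apply: (big_ind (fun w => exists v, i v = w)).
- by exists 0; rewrite /i linear0.
- by move=> _ _ [v <-] [v' <-]; exists (v + v'); rewrite /i linearD.
move=> l _; have [Xl|Xl] := pselect (X l); last by exists 0; rewrite /i linear0 aX.
have al u : a l (a l u) = a l u by rewrite aa eqxx.
exists (dsum_in (V := fun l : X => fixspace (a (sval l))) (SigSub (mem_set Xl))
  (fix_lift (f := a l) al w)).
by rewrite /i dsum_lift_in.
Qed.

Lemma comodule_sum_decomp : comod_decomp comodule_sum.
Proof.
split=> [l|]; first exact: comod_component_comodule.
apply/kisoP; split.
  apply: (lift_fixed_bijective (a := fun l => kh1 (e l))).
  - exact: comod_component1_eq.
  - exact: comod_component1_sum.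
  - by move=> l /comod_component_outside -> w.
apply: (lift_fixed_bijective (a := fun l => kh2 (e l))).
- exact: comod_component2_eq.
- exact: comod_component2_sum.
- by move=> l /comod_component_outside -> w.
Qed.
End ComoduleExistence.

Section ContramoduleExistence.
Variable C : krep k.
Hypothesis CX : contramodule X C.

Let CT : contramodule setT C := contramodule_sub (@subsetT _ X) CX.
Let e (l : P1 k) := contra_component CT l.
Let e1 l m : kh1 (e l) (kh1 (e l) m) = kh1 (e l) m.
Proof. by rewrite [LHS]contra_component1_eq eqxx. Qed.
Let e2 l m : kh2 (e l) (kh2 (e l) m) = kh2 (e l) m.
Proof. by rewrite [LHS]contra_component2_eq eqxx. Qed.

(** For [l] outside [X] the image of the idempotent is invertible on [X], so that it has
    no nonzero morphism to an [X]-contramodule. *)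
Lemma contra_component_outside l : ~ X l -> e l = kzero C C.
Proof.
move=> Xl.
have Nl : invertible_on X (kfix (e l)).
  apply/invertible_onP => m Xm; apply: (contramodule_disjoint (@contra_component_contramodule _
      _ CT l)).
  by apply/eqP => ml; apply: Xl; rewrite -ml.
have i0 := (CX Nl).1 (kfix_in (e l)).
apply: khom_ext => m.
  by rewrite -[LHS](kfix_inproj1 (e1 l) (e2 l)) i0.
by rewrite -[LHS](kfix_inproj2 (e1 l) (e2 l)) i0.
Qed.

Let N (l : X) : krep k := kfix (e (sval l)).

Definition contramodule_prod : khom C (kprod N) := @Khom k C (kprod N)
  (dprod_pair (fun l : X => kh1 (kfix_proj (e1 (sval l)) (e2 (sval l)))))
  (dprod_pair (fun l : X => kh2 (kfix_proj (e1 (sval l)) (e2 (sval l)))))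
  (fun v => functional_extensionality_dep (fun l : X => khf (kfix_proj (e1 (sval l)) (e2 (sval
      l))) v))
  (fun v => functional_extensionality_dep (fun l : X => khg (kfix_proj (e1 (sval l)) (e2 (sval
      l))) v)).

Lemma pair_fixed_bijective (W : lmodType k) (a : P1 k -> {linear W -> W})
    (aa : forall l w, a l (a l w) = a l w) :
  (forall w, (forall l, a l w = 0) -> w = 0) ->
  (forall x : P1 k -> W, (forall l, a l (x l) = x l) -> exists w, forall l, a l w = x l) ->
  (forall l, ~ X l -> forall w, a l w = 0) ->
  bijective (dprod_pair (T := fun l : X => fixspace (a (sval l)))
    (fun l : X => fix_liftl (aa (sval l)))).
Proof.
move=> ainj asurj aX; set p := dprod_pair _.
apply: (inj_surj_bijective (f := p)).
  apply: raddf_inj => w pw; apply: ainj => l.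
  have [Xl|Xl] := pselect (X l); last exact: aX.
  by have := congr1 (fun x => fix_val (x (SigSub (mem_set Xl) : X))) pw.
move=> x.
pose y (l : P1 k) : W := if pselect (X l) is left Xl
  then fix_val (x (SigSub (mem_set Xl) : X)) else 0.
have yE (l : X) : y (sval l) = fix_val (x l).
  rewrite /y; case: pselect => [Xl|]; last by case; exact: set_mem (svalP l).
  by congr (fix_val (x _)); exact: val_inj.
have [l|w wP] := asurj y.
  rewrite /y; case: pselect => [Xl|_]; last by rewrite linear0.
  exact: fix_valP (x (SigSub (mem_set Xl) : X)).
exists w; apply: functional_extensionality_dep => l; apply: val_inj.
by rewrite -[LHS]/(a (sval l) w) wP yE.
Qed.

Lemma contramodule_prod_decomp : contra_decomp contramodule_prod.
Proof.
split=> [l|]; first exact: contra_component_contramodule.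
apply/kisoP; split.
  apply: (pair_fixed_bijective (a := fun l => kh1 (e l)) e1).
  - exact: contra_component1_injective.
  - exact: contra_component1_surjective.
  - by move=> l /contra_component_outside -> w.
apply: (pair_fixed_bijective (a := fun l => kh2 (e l)) e2).
- exact: contra_component2_injective.
- exact: contra_component2_surjective.
- by move=> l /contra_component_outside -> w.
Qed.
End ContramoduleExistence.
End Existence.

(** * Uniqueness and functoriality *)

Section Functoriality.
Variables (k : fieldType) (X : set (P1 k)).

Lemma comodule_of_decomp (M : krep k) (N : X -> krep k) (i : khom (ksum N) M) :
  comod_decomp i -> comodule X M.
Proof.
move=> [NP iI]; apply: (comodule_iso iI); apply: ksum_comodule => l.
by apply: comodule_sub (@NP l) => m ->; exact: set_mem (svalP l).
Qed.

Lemma contramodule_of_decomp (C : krep k) (N : X -> krep k) (p : khom C (kprod N)) :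
  contra_decomp p -> contramodule X C.
Proof.
move=> [NP [q [qp pq]]]; apply: (contramodule_iso (i := q)); first by exists p.
apply: kprod_contramodule => l.
by apply: contramodule_sub (@NP l) => m ->; exact: set_mem (svalP l).
Qed.

Lemma comod_decomp_functorial (M M' : krep k) (f : khom M M') (N N' : X -> krep k)
    (i : khom (ksum N) M) (i' : khom (ksum N') M') :
  comod_decomp i -> comod_decomp i' ->
  exists! t : (forall l : X, khom (N l) (N' l)), kcomp i' (ksum_hom t) = kcomp f i.
Proof.
move=> [NP _] [N'P [j [ji ij]]].
have [t [tP tU]] := ksum_hom_diagonal NP N'P (kcomp j (kcomp f i)).
exists t; split; first by rewrite tP kcompA [kcomp i' j]ij kcomp1l.
by move=> t' e; apply: tU; rewrite -e kcompA [kcomp j i']ji kcomp1l.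
Qed.

Lemma contra_decomp_functorial (C C' : krep k) (f : khom C C') (N N' : X -> krep k)
    (p : khom C (kprod N)) (p' : khom C' (kprod N')) :
  contra_decomp p -> contra_decomp p' ->
  exists! t : (forall l : X, khom (N l) (N' l)), kcomp (kprod_hom t) p = kcomp p' f.
Proof.
move=> [NP [q [qp pq]]] [N'P _].
have [t [tP tU]] := kprod_hom_diagonal NP N'P (kcomp (kcomp p' f) q).
exists t; split; first by rewrite tP -kcompA [kcomp q p]qp kcomp1r.
by move=> t' e; apply: tU; rewrite -e -kcompA [kcomp p q]pq kcomp1r.
Qed.

Lemma comod_decomp_unique (M : krep k) (N N' : X -> krep k)
    (i : khom (ksum N) M) (i' : khom (ksum N') M) :
  comod_decomp i -> comod_decomp i' ->
  exists! t : (forall l : X, khom (N l) (N' l)),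
    (forall l, kiso (t l)) /\ kcomp i' (ksum_hom t) = i.
Proof.
move=> iP i'P.
have self (N0 : X -> krep k) (i0 : khom (ksum N0) M) (t : forall l, khom (N0 l) (N0 l)) :
    comod_decomp i0 -> kcomp i0 (ksum_hom t) = i0 -> forall l, t l = kid (N0 l).
  move=> i0P e l; have [t0 [_ tU]] := comod_decomp_functorial (kid M) i0P i0P.
  suff -> : t = fun l => kid (N0 l) by [].
  rewrite -(tU t) ?kcomp1l //; apply: tU.
  by rewrite ksum_hom_id kcomp1l kcomp1r.
have [t [tP tU]] := comod_decomp_functorial (kid M) iP i'P.
have [s [sP _]] := comod_decomp_functorial (kid M) i'P iP.
rewrite !kcomp1l in tP sP.
exists t; split; last by move=> t' [_ e]; apply: tU; rewrite e kcomp1l.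
split=> // l; exists (s l); split.
  by apply: (self _ _ (fun l => kcomp (s l) (t l)) iP); rewrite ksum_hom_comp kcompA sP.
by apply: (self _ _ (fun l => kcomp (t l) (s l)) i'P); rewrite ksum_hom_comp kcompA tP.
Qed.

Lemma contra_decomp_unique (C : krep k) (N N' : X -> krep k)
    (p : khom C (kprod N)) (p' : khom C (kprod N')) :
  contra_decomp p -> contra_decomp p' ->
  exists! t : (forall l : X, khom (N l) (N' l)),
    (forall l, kiso (t l)) /\ kcomp (kprod_hom t) p = p'.
Proof.
move=> pP p'P.
have self (N0 : X -> krep k) (p0 : khom C (kprod N0)) (t : forall l, khom (N0 l) (N0 l)) :
    contra_decomp p0 -> kcomp (kprod_hom t) p0 = p0 -> forall l, t l = kid (N0 l).
  move=> p0P e l; have [t0 [_ tU]] := contra_decomp_functorial (kid C) p0P p0P.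
  suff -> : t = fun l => kid (N0 l) by [].
  rewrite -(tU t) ?kcomp1r //; apply: tU.
  by rewrite kprod_hom_id kcomp1l kcomp1r.
have [t [tP tU]] := contra_decomp_functorial (kid C) pP p'P.
have [s [sP _]] := contra_decomp_functorial (kid C) p'P pP.
rewrite !kcomp1r in tP sP.
exists t; split; last by move=> t' [_ e]; apply: tU; rewrite e kcomp1r.
split=> // l; exists (s l); split.
  by apply: (self _ _ (fun l => kcomp (s l) (t l)) pP); rewrite kprod_hom_comp -kcompA tP.
by apply: (self _ _ (fun l => kcomp (t l) (s l)) p'P); rewrite kprod_hom_comp -kcompA sP.
Qed.

Lemma comod_sum_functor_equivalence :
  exists cl, is_equivalence (@comod_sum_functor k X cl).
Proof.
have cl (N : X -> krep k) : (forall l : X, comodule [set sval l] (N l)) -> comodule X (ksum N).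
  move=> NP; apply: (comodule_of_decomp (i := kid (ksum N))); split=> //.
  by exists (kid (ksum N)); split; exact: kcomp1l.
exists cl; apply: equivalence_fully_faithful_ess_surj => [N N' g|[M MX]].
  exact: (ksum_hom_diagonal (fun l => svalP (N l)) (fun l => svalP (N' l)) g).
have [NP iI] := comodule_sum_decomp MX.
exists (fun l : X => exist _ (kfix (comod_component (comodule_sub (@subsetT _ X) MX) (sval l)))
    (@NP l)).
by exists (comodule_sum MX).
Qed.

Lemma contra_prod_functor_equivalence :
  exists cl, is_equivalence (@contra_prod_functor k X cl).
Proof.
have cl (N : X -> krep k) : (forall l : X, contramodule [set sval l] (N l)) ->
    contramodule X (kprod N).
  move=> NP; apply: (contramodule_of_decomp (p := kid (kprod N))); split=> //.
  by exists (kid (kprod N)); split; exact: kcomp1l.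
exists cl; apply: equivalence_fully_faithful_ess_surj => [N N' g|[C CX]].
  exact: (kprod_hom_diagonal (fun l => svalP (N l)) (fun l => svalP (N' l)) g).
have [NP [q [qp pq]]] := contramodule_prod_decomp CX.
exists (fun l : X => exist _ (kfix (contra_component (contramodule_sub (@subsetT _ X) CX) (sval
    l))) (@NP l)).
by exists q, (contramodule_prod CX).
Qed.
End Functoriality.

(** * Comodules and contramodules at one point as spaces with an operator *)

Section OnePoint.
Variables (k : fieldType) (l : P1 k).

Lemma khom_of_linear (V W : krep k) (h : {linear kv1 V -> kv1 W}) :
  bijective (kF l V) ->
  (forall v w, kF l V w = kG l V v -> kF l W (h w) = kG l W (h v)) ->
  exists g : khom V W, forall v, kh1 g v = h v.
Proof.
move=> /bijective_linear_inv[fi [fK fiK]] hP.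
pose h2 : {linear kv2 V -> kv2 W} := kF l W \o (h \o fi).
have hF v : kF l W (h v) = h2 (kF l V v) by rewrite /h2 /= fK.
have hG v : kG l W (h v) = h2 (kG l V v) by rewrite /h2 /= -(hP v (fi (kG l V v))) // fiK.
by exists (khom_of hF hG).
Qed.

Lemma khom_ext1 (V W : krep k) (g g' : khom V W) : bijective (kF l V) ->
  kh1 g =1 kh1 g' -> g = g'.
Proof.
move=> [fi fK fiK] e; apply: khom_ext => // v.
by rewrite -[v]fiK -!khF e.
Qed.

Section Locnil.
Notation comod := (comod_cat [set l]).

Definition point_op (N : comod) : {linear kv1 (sval N) -> kv1 (sval N)} :=
  sval (cid (comodule_pointP (svalP N)).2).
Lemma point_opP (N : comod) :
  (forall m, kF l (sval N) (point_op N m) = kG l (sval N) m) /\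
  locally_nilpotent (point_op N).
Proof. exact: svalP (cid (comodule_pointP (svalP N)).2). Qed.
Lemma comod_F (N : comod) : bijective (kF l (sval N)).
Proof. exact: (comodule_pointP (svalP N)).1. Qed.

Fact point_op_nilp (N : comod) m : exists2 n, (1 <= n)%N & iter n (point_op N) m = 0.
Proof.
have [n e] := (point_opP N).2 m; exists n.+1 => //.
by rewrite iterS e linear0.
Qed.

Definition locnil_of (N : comod) : locnil_cat k := Locnil (@point_op_nilp N).

Fact locnil_of_homP (N N' : comod) (h : hom N N') m :
  kh1 h (point_op N m) = point_op N' (kh1 h m).
Proof.
apply: (bij_inj (comod_F N')).
by rewrite khF (point_opP N).1 (point_opP N').1 -khG.
Qed.
Definition locnil_of_hom (N N' : comod) (h : hom N N') : hom (locnil_of N) (locnil_of N') :=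
  @LocnilHom k (locnil_of N) (locnil_of N') (kh1 h) (@locnil_of_homP N N' h).

Fact locnil_of_hom_id (N : comod) : locnil_of_hom (idm N) = idm (locnil_of N).
Proof. exact: locnil_hom_ext. Qed.
Fact locnil_of_hom_comp (N N' N'' : comod) (g : hom N' N'') (f : hom N N') :
  locnil_of_hom (compm g f) = compm (locnil_of_hom g) (locnil_of_hom f).
Proof. exact: locnil_hom_ext. Qed.

Definition locnil_functor : functor comod (locnil_cat k) :=
  Functor locnil_of_hom_id locnil_of_hom_comp.

Lemma comod_locnil_equivalent : equivalent comod (locnil_cat k).
Proof.
exists locnil_functor; apply: equivalence_fully_faithful_ess_surj => [N N' g|[W z zn]].
  have [h hP] : exists h : khom (sval N) (sval N'), forall v, kh1 h v = lnh g v.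
    apply: khom_of_linear (comod_F N) _ => v w e.
    rewrite -(point_opP N').1 -[point_op _ _](lnhP g); congr (kF l _ (lnh g _)).
    by apply: (bij_inj (comod_F N)); rewrite (point_opP N).1.
  exists h; split=> [|h' e]; first by apply: locnil_hom_ext.
  apply: (khom_ext1 (comod_F N)) => v; rewrite hP.
  by have := congr1 (fun g : locnil_hom (locnil_of N) (locnil_of N') => lnh g v) e.
pose K := @pencil_rep k l W W idfun z.
have KP : comodule [set l] K.
  apply: (comodule_point (z := (z : {linear kv1 K -> kv1 K}))).
  - by exists idfun => v; rewrite kF_pencil.
  - by move=> m; rewrite kF_pencil kG_pencil.
  - by move=> m; have [n _ e] := zn m; exists n.
pose N : comod := exist _ K KP.
have opE m : point_op N m = z m.
  by apply: (bij_inj (comod_F N)); rewrite (point_opP N).1 kF_pencil kG_pencil.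
exists N.
exists (@LocnilHom k (locnil_of N) (Locnil zn) idfun opE).
exists (@LocnilHom k (Locnil zn) (locnil_of N) idfun (fun m => esym (opE m))).
by split; apply: locnil_hom_ext.
Qed.
End Locnil.

Section Zsum.
Notation contra := (contra_cat [set l]).

Lemma contra_summable (C : contra) : uniquely_summable l (sval C).
Proof. exact/contramodule_pointP/(svalP C). Qed.
Lemma contra_F (C : contra) : bijective (kF l (sval C)).
Proof. exact: uniquely_summable_F (contra_summable C). Qed.

(** The solution [h] of [h_n - z h_(n+1) = c_n]. *)
Definition tail_sums (C : contra) (c : nat -> kv1 (sval C)) : nat -> kv1 (sval C) :=
  sval (cid ((contra_summable C).1 (fun n => kF l (sval C) (c n)))).
Lemma tail_sumsP C c n :
  kF l (sval C) (@tail_sums C c n) - kG l (sval C) (tail_sums c n.+1) = kF l (sval C) (c n).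
Proof. exact: (svalP (cid ((contra_summable C).1 (fun n => kF l (sval C) (c n))))). Qed.
Lemma tail_sums_unique C c h :
  (forall n, kF l (sval C) (h n) - kG l (sval C) (h n.+1) = kF l (sval C) (c n)) ->
  forall n, @tail_sums C c n = h n.
Proof.
by move=> hP; apply: (uniquely_summable_eq (contra_summable C)) => n; rewrite hP tail_sumsP.
Qed.

Definition contra_sum (C : contra) (c : nat -> kv1 (sval C)) : kv1 (sval C) := tail_sums c 0.

Fact contra_sum_linear C : linear (@contra_sum C).
Proof.
move=> a c d; apply: (tail_sums_unique (h := fun n => a *: tail_sums c n + tail_sums d n)) => n.
rewrite (linearPZ (kF l (sval C))) (linearPZ (kG l (sval C))) opprD addrACA -scalerBr.
by rewrite !tail_sumsP -(linearPZ (kF l (sval C))).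
Qed.

Fact contra_sum_unit C (c : nat -> kv1 (sval C)) :
  (forall n, (1 <= n)%N -> c n = 0) -> contra_sum c = c 0%N.
Proof.
move=> c0; apply: (tail_sums_unique (h := c)) => n.
by rewrite (c0 n.+1) // (linear0 (kG l (sval C))) subr0.
Qed.

(** If [h^i] solves the system for the [i]-th row and [H] the one for the sequence of the
    [h^i_0], then the [K_n] below solve it for the sequence of antidiagonal sums, and
    [K_0 = H_0]. *)
Fact contra_sum_assoc C (c : nat -> nat -> kv1 (sval C)) :
  contra_sum (fun i => contra_sum (fun j => c i j)) =
  contra_sum (fun n => \sum_(i < n.+1) c i (n - i)%N).
Proof.
pose H := tail_sums (fun i => contra_sum (fun j => c i j)).
pose K n := H n + \sum_(i < n) tail_sums (c i) (n - i)%N.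
suff e : forall n, tail_sums (fun n => \sum_(i < n.+1) c i (n - i)%N) n = K n.
  by rewrite [RHS]e /K big_ord0 addr0.
apply: tail_sums_unique => n; rewrite /K.
rewrite (linearD (kF l (sval C))) (linearD (kG l (sval C))) opprD addrACA tail_sumsP.
rewrite !linear_sum /=.
rewrite [RHS](eq_bigr (fun i : 'I_n.+1 => kF l (sval C) (tail_sums (c i) (n - i)%N) -
  kG l (sval C) (tail_sums (c i) (n.+1 - i)%N))) => [|i _].
  rewrite sumrB [in RHS]big_ord_recr /= subnn addrA sumrN.
  by congr (_ - _); rewrite addrC.
by rewrite subSn ?tail_sumsP // -ltnS.
Qed.

Definition zsum_of (C : contra) : zsum_cat k :=
  Zsum (zs_sum := build_linear (@contra_sum_linear C)) (@contra_sum_unit C) (@contra_sum_assoc C).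

Fact zsum_of_homP (C C' : contra) (h : hom C C') (c : nat -> kv1 (sval C)) :
  kh1 h (contra_sum c) = contra_sum (fun n => kh1 h (c n)).
Proof.
apply/esym/(tail_sums_unique (h := fun n => kh1 h (tail_sums c n))) => n.
by rewrite !khF khG -(linearB (kh2 h)) tail_sumsP.
Qed.
Definition zsum_of_hom (C C' : contra) (h : hom C C') : hom (zsum_of C) (zsum_of C') :=
  @ZsumHom k (zsum_of C) (zsum_of C') (kh1 h) (zsum_of_homP h).

Fact zsum_of_hom_id (C : contra) : zsum_of_hom (idm C) = idm (zsum_of C).
Proof. exact: zsum_hom_ext. Qed.
Fact zsum_of_hom_comp (C C' C'' : contra) (g : hom C' C'') (f : hom C C') :
  zsum_of_hom (compm g f) = compm (zsum_of_hom g) (zsum_of_hom f).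
Proof. exact: zsum_hom_ext. Qed.

Definition zsum_functor : functor contra (zsum_cat k) :=
  Functor zsum_of_hom_id zsum_of_hom_comp.

(** The operator [z] is recovered from the summation. *)
Lemma contra_sum_shift (C : contra) m w : kF l (sval C) w = kG l (sval C) m ->
  contra_sum (fun n => if n == 1%N then m else 0) = w.
Proof.
move=> e; apply: (tail_sums_unique (h := fun n => if n is n'.+1 then if n' is 0 then m else 0
    else w)).
by case=> [|[|n]] /=; rewrite ?e ?(linear0 (kF l _)) ?(linear0 (kG l _)) ?subrr ?subr0.
Qed.

Section ZsumRep.
Variable W : zsum k.
Local Notation E := (zs_space W).
Local Notation s := (zs_sum W).

Definition zs_op (w : E) : E := s (fun n => if n == 1%N then w else 0).
Fact zs_op_linear : linear zs_op.
Proof.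
move=> a x y; rewrite /zs_op -linearP; congr (s _); apply: funext => n.
rewrite -[RHS]/(a *: (if n == 1%N then x else 0) + (if n == 1%N then y else 0)).
by case: eqP; rewrite ?scaler0 ?addr0.
Qed.

(** The operator defined by a summation moves all terms one place up; this is
    associativity for a double sequence concentrated in the row [i = 1].  In [zs_sum_op]
    the double sequence is concentrated in the column [j = 1]. *)
Lemma zs_op_sum (b : nat -> E) : zs_op (s b) = s (fun n => if n is n'.+1 then b n' else 0).
Proof.
have := zs_assoc (z := W) (fun i j => if i == 1%N then b j else 0).
have -> : (fun i => s (fun j => if i == 1%N then b j else 0)) =
    (fun i => if i == 1%N then s b else 0).
  by apply: funext => i; case: eqP => // _; exact: (linear0 s).
rewrite /zs_op => ->; congr (s _); apply: funext => -[|n].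
  by rewrite big_ord_recl big_ord0 addr0.
rewrite (bigD1 (Ordinal (isT : (1 < n.+2)%N))) //= subSS subn0 big1 ?addr0 // => i.
by rewrite -val_eqE /= => /negPf ->.
Qed.

Lemma zs_sum_op (h : nat -> E) :
  s (fun i => zs_op (h i.+1)) = s (fun n => if n is 0 then 0 else h n).
Proof.
rewrite (zs_assoc (z := W) (fun i j => if j == 1%N then h i.+1 else 0)).
congr (s _); apply: funext => -[|n].
  by rewrite big_ord_recl big_ord0 addr0.
rewrite !big_ord_recr /= subSnn subnn addr0 big1 ?add0r // => i _.
by rewrite subSn ?(ltnW (ltn_ord i)) // eqSS subn_eq0 leqNgt ltn_ord.
Qed.

Lemma zs_split (b : nat -> E) : s b = b 0%N + s (fun n => if n is 0 then 0 else b n).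
Proof.
rewrite -[b 0%N](zs_unit (z := W) (c := fun n => if n is 0 then b 0%N else 0)) => [|[]//].
rewrite -linearD; congr (s _); apply: funext => -[|n].
  exact: esym (addr0 _).
exact: esym (add0r _).
Qed.

Definition zs_rep : krep k := @pencil_rep k l E E idfun (build_linear zs_op_linear).

Lemma zs_rep_tail (b : nat -> E) n :
  s (fun i => b (n + i)%N) - zs_op (s (fun i => b (n.+1 + i)%N)) = b n.
Proof.
rewrite zs_op_sum zs_split addn0 -[RHS]addr0 -addrA; congr (_ + _).
rewrite -[X in _ = X](subrr (s (fun i => if i is i'.+1 then b (n.+1 + i')%N else 0))).
by congr (s _ - _); apply: funext => -[|i] //; rewrite addSnnS.
Qed.

(** Solutions are the sums of the tails.  If [g_n = z g_(n+1)] for all [n], then summing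
    these equations cancels everything except [g_0]. *)
Lemma zs_rep_contramodule : contramodule [set l] zs_rep.
Proof.
apply/contramodule_pointP; split=> [c|h hP].
  exists (fun n => s (fun i => c (n + i)%N)) => n.
  by rewrite kF_pencil kG_pencil; exact: zs_rep_tail.
have z0 (g : nat -> E) : (forall n, g n = zs_op (g n.+1)) -> g 0%N = 0.
  move=> gP; have := zs_sum_op g.
  have -> : (fun i => zs_op (g i.+1)) = g by apply: funext => i; rewrite -gP.
  by rewrite zs_split => /(canRL (addrK _)); rewrite subrr.
move=> n; rewrite -[n]add0n; apply: (z0 (fun i => h (i + n)%N)) => i.
by have := hP (i + n)%N; rewrite kF_pencil kG_pencil.
Qed.
End ZsumRep.

Lemma contra_zsum_equivalent : equivalent contra (zsum_cat k).
Proof.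
exists zsum_functor; apply: equivalence_fully_faithful_ess_surj => [C C' g|W].
  have [h hP] : exists h : khom (sval C) (sval C'), forall v, kh1 h v = zsh g v.
    apply: khom_of_linear (contra_F C) _ => v w e.
    have [w' e'] : exists w', kF l (sval C') w' = kG l (sval C') (zsh g v).
      by have [f _ fK] := contra_F C'; exists (f (kG l (sval C') (zsh g v))).
    rewrite -e' -(contra_sum_shift e) -(contra_sum_shift e').
    have gE c : zsh g (contra_sum c) = contra_sum (fun n => zsh g (c n)) := zshP g c.
    rewrite gE; congr (kF l _ (contra_sum _)).
    by apply: funext => n; case: eqP => // _; exact: (linear0 (zsh g)).
  exists h; split=> [|h' e]; first by apply: zsum_hom_ext.
  apply: (khom_ext1 (contra_F C)) => v; rewrite hP.
  by have := congr1 (fun g : zsum_hom (zsum_of C) (zsum_of C') => zsh g v) e.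
pose C : contra := exist _ (zs_rep W) (@zs_rep_contramodule W).
have sumE (c : nat -> zs_space W) : @contra_sum C c = zs_sum W c.
  apply: (tail_sums_unique (C := C) (h := fun n => zs_sum W (fun i => c (n + i)%N))) => n.
  by rewrite !kF_pencil kG_pencil; exact: zs_rep_tail.
exists C.
exists (@ZsumHom k (zsum_of C) W idfun sumE).
exists (@ZsumHom k W (zsum_of C) idfun (fun c => esym (sumE c))).
by split; apply: zsum_hom_ext.
Qed.
End Zsum.
End OnePoint.

Theorem theorem8p8 (k : closedFieldType) (X : set (P1 k)) (Xoo : X None) :
  (* (a) *)
  [/\ (* existence of the decomposition *)
      forall M : krep k, comodule X M ->
        exists (N : X -> krep k) (i : khom (ksum N) M), comod_decomp i,
      (* its uniqueness *)
      forall M : krep k, comodule X M ->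
        forall (N N' : X -> krep k)
          (i : khom (ksum N) M) (i' : khom (ksum N') M),
        comod_decomp i -> comod_decomp i' ->
        exists! t : (forall l : X, khom (N l) (N' l)),
          (forall l, kiso (t l)) /\ kcomp i' (ksum_hom t) = i,
      (* its functoriality *)
      forall M M' : krep k, comodule X M -> comodule X M' ->
        forall (f : khom M M') (N N' : X -> krep k)
          (i : khom (ksum N) M) (i' : khom (ksum N') M'),
        comod_decomp i -> comod_decomp i' ->
        exists! t : (forall l : X, khom (N l) (N' l)),
          kcomp i' (ksum_hom t) = kcomp f i,
      (* direct sums of {l}-comodules are X-comodules *)
      forall (M : krep k) (N : X -> krep k) (i : khom (ksum N) M),
        comod_decomp i -> comodule X M &
      (* equivalences of categories *)
      (exists cl, is_equivalence (@comod_sum_functor k X cl)) /\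
      (forall l : P1 k, X l -> equivalent (comod_cat [set l]) (locnil_cat k))]
  /\
  (* (b) *)
  [/\ forall C : krep k, contramodule X C ->
        exists (N : X -> krep k) (p : khom C (kprod N)), contra_decomp p,
      forall C : krep k, contramodule X C ->
        forall (N N' : X -> krep k)
          (p : khom C (kprod N)) (p' : khom C (kprod N')),
        contra_decomp p -> contra_decomp p' ->
        exists! t : (forall l : X, khom (N l) (N' l)),
          (forall l, kiso (t l)) /\ kcomp (kprod_hom t) p = p',
      forall C C' : krep k, contramodule X C -> contramodule X C' ->
        forall (f : khom C C') (N N' : X -> krep k)
          (p : khom C (kprod N)) (p' : khom C' (kprod N')),
        contra_decomp p -> contra_decomp p' ->
        exists! t : (forall l : X, khom (N l) (N' l)),
          kcomp (kprod_hom t) p = kcomp p' f,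
      forall (C : krep k) (N : X -> krep k) (p : khom C (kprod N)),
        contra_decomp p -> contramodule X C &
      (exists cl, is_equivalence (@contra_prod_functor k X cl)) /\
      (forall l : P1 k, X l -> equivalent (contra_cat [set l]) (zsum_cat k))].
Proof.
split; split.
- by move=> M MX; exists _, (comodule_sum MX); exact: comodule_sum_decomp.
- by move=> M _ N N' i i'; exact: comod_decomp_unique.
- by move=> M M' _ _ f N N' i i'; exact: comod_decomp_functorial.
- by move=> M N i; exact: comodule_of_decomp.
- split; first exact: comod_sum_functor_equivalence.
  by move=> l _; exact: comod_locnil_equivalent.
- by move=> C CX; exists _, (contramodule_prod CX); exact: contramodule_prod_decomp.
- by move=> C _ N N' p p'; exact: contra_decomp_unique.
- by move=> C C' _ _ f N N' p p'; exact: contra_decomp_functorial.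
- by move=> C N p; exact: contramodule_of_decomp.
- split; first exact: contra_prod_functor_equivalence.
  by move=> l _; exact: contra_zsum_equivalent.
Qed.
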